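(* Let $n\geq1$ and $d\geq0$. Then \[\mathbb{Q}[x_1,\ldots,x_n]_d=\bigoplus_{\lambda\vdash n}\ \bigoplus_{M\in\operatorname{SSYT}_d(\lambda)}V_M ,\] and the sum on the right is direct. Moreover, for every multiset $\mu$ of $n$ non-negative integers with sum $d$, the subrepresentation $\mathbb{Q}[x_1,\ldots,x_n]_\mu$ equals the partial sum $\bigoplus_{\lambda\vdash n}\bigoplus_{M\in\operatorname{SSYT}_\mu(\lambda)}V_M$.
   Context: $S_n$ acts on $\mathbb{Q}[x_1,\ldots,x_n]$ by $\sigma\cdot x_i=x_{\sigma(i)}$, and this action is extended linearly to the group algebra. $\mathbb{Q}[x_1,\ldots,x_n]_d$ denotes the homogeneous part of degree $d$. For a multiset $\mu$ of $n$ non-negative integers, $\mathbb{Q}[x_1,\ldots,x_n]_\mu$ is the span of the monomials $x_1^{a_1}\cdots x_n^{a_n}$ with $\{a_1,\ldots,a_n\}=\mu$ as multisets. Partitions $\lambda\vdash n$ are identified with their Ferrers diagrams (English convention). $\operatorname{SSYT}(\lambda)$ is the set of fillings of $\lambda$ by non-negative integers that weakly increase along rows and strictly increase down columns. For $M\in\operatorname{SSYT}(\lambda)$, $\Sigma(M)$ is its entry sum and its content is the multiset of its entries. $\operatorname{SSYT}_d(\lambda)$ is the set of $M$ with $\Sigma(M)=d$, and $\operatorname{SSYT}_\mu(\lambda)$ is the set of $M$ with content $\mu$. For a filling $T$ of $\lambda$ by $1,\ldots,n$, each used once: - $R(T)$ and $C(T)$ are the subgroups of $S_n$ preserving the set of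 entries of each row, respectively of each column. - $\varepsilon_T=\sum_{\sigma\in C(T)}\sum_{\tau\in R(T)}\operatorname{sgn}(\sigma)\sigma\tau$. - For $M\in\operatorname{SSYT}(\lambda)$, $p_{M,T}=\prod_{i=1}^n x_i^{h_i}$, where $h_i$ is the entry of $M$ in the box containing $i$ in $T$. - $s_{M,T}$ is the number of $\tau\in R(T)$ fixing $p_{M,T}$. - $F_{M,T}=\varepsilon_T p_{M,T}/s_{M,T}$. $V_M$ is the $\mathbb{Q}$-span of all $F_{M,T}$, where $T$ runs over all such fillings of $\lambda$. *)

(* Defs.v *)
From HB Require Import structures.
From mathcomp Require Import all_boot all_order all_fingroup all_algebra.
From mathcomp Require Import finmap multiset mpoly.

Set Implicit Arguments.
Unset Strict Implicit.
Unset Printing Implicit Defensive.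

Import GRing.Theory.

Local Open Scope ring_scope.

(* {mpoly rat[n]} is infinite-dimensional and hence not a vectType, so that
   {vspace _} and directv are not available on it; its subspaces are handled
   here as predicates. *)
Section Subspaces.
Variables (K : fieldType) (V : lmodType K).

Definition lspan (S : V -> Prop) (v : V) : Prop :=
  exists s : seq (K * V),
    (forall x, x \in s -> S x.2) /\ v = \sum_(x <- s) x.1 *: x.2.

Variables (I : eqType) (P : pred I) (W : I -> V -> Prop).

(* The sum of the subspaces W i over all i such that P i: there may be
   infinitely many such i, but each vector involves only finitely many. *)
Definition subspace_sum (v : V) : Prop :=
  exists (s : seq I) (w : I -> V),
    [/\ uniq s, all P s, forall i, i \in s -> W i (w i)
      & v = \sum_(i <- s) w i].

Definition subspace_direct : Prop :=
  forall (s : seq I) (w : I -> V),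
    uniq s -> all P s -> (forall i, i \in s -> W i (w i)) ->
    \sum_(i <- s) w i = 0 -> forall i, i \in s -> w i = 0.

Definition is_direct_sum (U : V -> Prop) : Prop :=
  (forall v, U v <-> subspace_sum v) /\ subspace_direct.

End Subspaces.

Definition is_intpart (n : nat) (la : seq nat) : bool :=
  [&& sorted geq la, all (leq 1) la & sumn la == n].

Definition intpart (n : nat) := {la : seq nat | is_intpart n la}.

Section Tableaux.
Variables (n : nat) (la : intpart n).

(* Row and column indices start at 0; those of a box of a partition of n are
   always less than n. *)
Definition box := {b : 'I_n * 'I_n | (b.2 < nth 0 (val la) b.1)%N}.

Definition box_row (b : box) : 'I_n := (val b).1.
Definition box_col (b : box) : 'I_n := (val b).2.

Definition is_ssyt (M : {ffun box -> nat}) : bool :=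
  [forall a : box, forall b : box,
     ((box_row a == box_row b) && (box_col a < box_col b)%N ==> (M a <= M b)%N)
  && ((box_col a == box_col b) && (box_row a < box_row b)%N ==> (M a < M b)%N)].

Definition ssyt := {M : {ffun box -> nat} | is_ssyt M}.

Definition ssyt_sum (M : ssyt) : nat := (\sum_(b : box) val M b)%N.

Definition ssyt_content (M : ssyt) : {mset nat}%mset :=
  seq_mset [seq val M b | b : box].

(* The numbers 1, ..., n of the mathematical text are the elements of 'I_n. *)
Definition is_numbering (T : {ffun box -> 'I_n}) : bool :=
  injectiveb T && [forall i : 'I_n, i \in codom T].

Definition numbering := {T : {ffun box -> 'I_n} | is_numbering T}.

Lemma numbering_codom (T : numbering) (i : 'I_n) : i \in codom (val T).
Proof. by case/andP: (valP T) => _ /forallP. Qed.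

Definition box_of (T : numbering) (i : 'I_n) : box :=
  iinv (numbering_codom T i).

Definition row_entries (T : numbering) (r : 'I_n) : {set 'I_n} :=
  [set val T b | b : box & box_row b == r].
Definition col_entries (T : numbering) (c : 'I_n) : {set 'I_n} :=
  [set val T b | b : box & box_col b == c].

Definition row_stab (T : numbering) : {set 'S_n} :=
  [set s : 'S_n | [forall r, s @: row_entries T r == row_entries T r]].
Definition col_stab (T : numbering) : {set 'S_n} :=
  [set s : 'S_n | [forall c, s @: col_entries T c == col_entries T c]].

(* msym s substitutes 'X_(s i) for 'X_i.  The product of the group algebra acts
   here as the composition of the actions, in which t is applied first; it is
   written t * s in the group 'S_n, where (t * s) i = s (t i). *)
Definition young_symm (T : numbering) (p : {mpoly rat[n]}) : {mpoly rat[n]} :=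
  \sum_(s in col_stab T) \sum_(t in row_stab T)
    (-1) ^+ s *: msym s (msym t p).

Definition tab_mon (M : ssyt) (T : numbering) : {mpoly rat[n]} :=
  \prod_(i < n) 'X_i ^+ val M (box_of T i).

Definition row_fix (M : ssyt) (T : numbering) : nat :=
  #|[set t in row_stab T | msym t (tab_mon M T) == tab_mon M T]|.

Definition specht_poly (M : ssyt) (T : numbering) : {mpoly rat[n]} :=
  (row_fix M T)%:R^-1 *: young_symm T (tab_mon M T).

Definition specht_space (M : ssyt) : {mpoly rat[n]} -> Prop :=
  lspan (fun p => exists T : numbering, p = specht_poly M T).

End Tableaux.

Definition content_space (n : nat) (mu : {mset nat}%mset) : {mpoly rat[n]} -> Prop :=
  lspan (fun p => exists2 m : 'X_{1..n},
                    seq_mset [seq m i | i : 'I_n] = mu & p = 'X_[m]).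

Definition ssyt_index (n : nat) := {la : intpart n & ssyt la}.

HB.instance Definition _ (n : nat) := Choice.on (ssyt_index n).

(* Main.v *)
Require Import Defs.
From mathcomp Require Import all_boot all_order all_fingroup all_algebra.
From mathcomp Require Import finmap multiset mpoly.
From HB Require Import structures.
From mathcomp Require Import zify ring.
From Stdlib Require Import Classical.

(* Write a_T and b_T for the row symmetrizer and the signed column symmetrizer
   of T, so that F_{M,T} is a multiple of b_T a_T p_{M,T}. Both are self-adjoint
   for the inner product in which the monomials are orthonormal.

   Directness. If g is a permutation then b_T g a_T' vanishes unless no two
   numbers share a column of T and a row of g T'. Comparing numbers of entries
   in the first k rows, this makes V_M and V_M' orthogonal when the shapes
   differ; when T = T' it gives b_T g a_T = e b_T a_T with a scalar e.
   Hence b_T maps each v in V_M to a multiple of F_{M,T}. For fixed T the F_{M,T}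
   with M semistandard are independent (look at the monomial maximizing
   sum_i row(i) a_i), so if a sum of such v vanishes, every b_T kills every v,
   and then v is orthogonal to V_M, i.e. v = 0.

   Spanning. Let w be orthogonal to every F_{M,T} with M semistandard. Then
   z = a_T b_T w has zero coefficients at semistandard monomials, and the Garnir
   relations force z = 0. If w <> 0, choose a coloring c of {1..n} with the sum
   of the squared fibre sizes maximal among those whose signed symmetrizer does
   not kill w, and then r likewise for the plain symmetrizer and the vector
   obtained. By maximality, the sum of all transpositions acts on either vector
   by a scalar computed from the fibre sizes. Since it is central, the two
   scalars agree, which forces (r, c) to be, up to reordering rows and columns,
   the row and column functions of a numbering T of a partition; so
   a_T b_T w <> 0, a contradiction. *)

Set Implicit Arguments.
Unset Strict Implicit.
Unset Printing Implicit Defensive.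

Import Order.TTheory GRing.Theory Num.Theory.

Local Open Scope ring_scope.

(** * Signed symmetrizers over the fibres of a coloring *)

Section Symmetrizers.
Variable n : nat.
Implicit Types (c : 'I_n -> 'I_n) (s t g : 'S_n) (p q : {mpoly rat[n]}).

(** Young subgroups are given by colorings, so that row stabilizers, column stabilizers and
    symmetric groups of subsets are all instances. *)
Definition stab c : pred 'S_n := fun s => [forall x, c (s x) == c x].

Lemma stabP c s : reflect (forall x, c (s x) = c x) (stab c s).
Proof. exact: 'forall_eqP. Qed.

Lemma stab1 c : stab c 1%g.
Proof. by apply/stabP => x; rewrite perm1. Qed.

Lemma stabMl c s t : stab c s -> stab c (s * t)%g = stab c t.
Proof.
move=> /stabP cs; apply/stabP/stabP => ct x; last by rewrite permM ct cs.
by rewrite -[x](permKV s) -permM ct cs.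
Qed.

Lemma stabMr c s t : stab c s -> stab c (t * s)%g = stab c t.
Proof.
by move=> /stabP cs; apply/stabP/stabP => ct x; move: (ct x); rewrite permM cs.
Qed.

Lemma stabV c s : stab c s^-1%g = stab c s.
Proof. by apply/stabP/stabP => cs x; rewrite -(cs (_ x)) ?permK ?permKV. Qed.

Lemma stab_tperm c x y : c x = c y -> stab c (tperm x y).
Proof. by move=> cxy; apply/stabP => z; case: tpermP => // ->. Qed.

Definition chi (e : bool) s : rat := (-1) ^+ (e && s).

Lemma chiM e s t : chi e (s * t)%g = chi e s * chi e t.
Proof. by rewrite /chi odd_permM -signr_addb; case: e. Qed.

Lemma chiV e s : chi e s^-1%g = chi e s.
Proof. by rewrite /chi odd_permV. Qed.

Lemma chi1 e : chi e 1%g = 1.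
Proof. by rewrite /chi odd_perm1 andbF. Qed.

Lemma chi_false s : chi false s = 1.
Proof. by []. Qed.

Lemma chi_tperm e x y : x != y -> chi e (tperm x y) = (-1) ^+ e.
Proof. by move=> xy; rewrite /chi odd_tperm xy andbT. Qed.

Lemma chi2 e s : chi e s * chi e s = 1.
Proof. by rewrite -signr_addb addbb. Qed.

Lemma chi_neq0 e s : chi e s != 0.
Proof. by rewrite signr_eq0. Qed.

Definition sym e c p : {mpoly rat[n]} := \sum_(s | stab c s) chi e s *: msym s p.

Lemma sym_is_linear e c : linear (sym e c).
Proof.
move=> a p q; rewrite /sym scaler_sumr -big_split /=; apply: eq_bigr => s _.
by rewrite linearP scalerDr !scalerA mulrC.
Qed.

HB.instance Definition _ e c :=
  GRing.isLinear.Build rat {mpoly rat[n]} {mpoly rat[n]} _ (sym e c)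
    (sym_is_linear e c).

Lemma eq_stab_sym e c c' p : (forall s, stab c s = stab c' s) -> sym e c p = sym e c' p.
Proof. by move=> cc'; apply: eq_bigl. Qed.

Lemma sym_stabl e c s p : stab c s -> msym s (sym e c p) = chi e s *: sym e c p.
Proof.
move=> cs; rewrite /sym linear_sum scaler_sumr.
rewrite (reindex_inj (mulIg s^-1)%g); apply: eq_big => t; last first.
  move=> _; rewrite linearZ /= -msymMm mulgKV chiM chiV scalerA.
  by rewrite [_ * chi e s]mulrC.
by rewrite stabMr ?stabV.
Qed.

Lemma sym_stabr e c s p : stab c s -> sym e c (msym s p) = chi e s *: sym e c p.
Proof.
move=> cs; rewrite /sym scaler_sumr.
rewrite (reindex_inj (mulgI s^-1)%g); apply: eq_big => t.
  by rewrite stabMl ?stabV.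
by rewrite -msymMm mulKVg chiM chiV scalerA.
Qed.

Lemma eq_opp0 (V : lmodType rat) (v : V) : v = - v -> v = 0.
Proof.
move/eqP; rewrite -subr_eq0 opprK -mulr2n -scaler_nat scaler_eq0.
by rewrite pnatr_eq0 /= => /eqP.
Qed.

(** [sym e c] absorbs [t] at the cost of [chi e t], so under this hypothesis [sym e c p] is its own
    opposite. *)
Lemma sym_eq0 e c t p : stab c t -> msym t p = - chi e t *: p -> sym e c p = 0.
Proof.
move=> ct tp; have := sym_stabr e p ct; rewrite tp linearZ /= scaleNr => /esym.
by move/eq_opp0/eqP; rewrite scaler_eq0 (negPf (chi_neq0 _ _)) => /eqP.
Qed.

Lemma stabJ c g s : stab (c \o g) s = stab c (s ^ g)%g.
Proof.
apply/stabP/stabP => cs x /=; last first.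
  by have := cs (g x); rewrite permJ /=.
by rewrite -[x](permKV g) permJ; have /= -> := cs ((g^-1)%g x).
Qed.

(** The permutation [g] maps the fibres of [c \o g] onto those of [c], so conjugation by it
    identifies the two stabilizers. *)
Lemma symJ e c g p : msym g (sym e (c \o g) p) = sym e c (msym g p).
Proof.
rewrite /sym linear_sum [RHS](reindex_inj (conjg_inj g)).
apply: eq_big => s; first by rewrite stabJ.
move=> _; rewrite linearZ /= -!msymMm conjgE !mulgA mulgV mul1g.
by rewrite /chi !odd_permM odd_permV addbAC addbb.
Qed.

(* The monomials of degree at least k are ignored. *)
Definition ip k p q : rat := \sum_(m : 'X_{1..n < k}) p@_m * q@_m.

Lemma ipC k p q : ip k p q = ip k q p.
Proof. by apply: eq_bigr => m _; rewrite mulrC. Qed.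

Lemma ip_is_linear k p : linear_for *%R (ip k p).
Proof.
move=> a q r; rewrite /ip mulr_sumr -big_split; apply: eq_bigr => m _ /=.
by rewrite mcoeffD mcoeffZ; ring.
Qed.

HB.instance Definition _ k p :=
  GRing.isLinear.Build rat {mpoly rat[n]} rat *%R (ip k p) (ip_is_linear k p).

Lemma ip_msym k s p q : ip k (msym s p) q = ip k p (msym s^-1%g q).
Proof.
pose h (t : 'S_n) (m : 'X_{1..n < k}) : 'X_{1..n < k} :=
  insubd m [multinom (m : 'X_{1..n}) (t i) | i < n].
have hE t m : h t m = [multinom (m : 'X_{1..n}) (t i) | i < n] :> 'X_{1..n}.
  by rewrite insubdK // unfold_in /= mdeg_mperm bmdeg.
have hK t : cancel (h t) (h t^-1)%g.
  move=> m; apply/val_inj => /=; rewrite hE; apply/mnmP => i.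
  by rewrite mnmE hE mnmE permKV.
rewrite /ip (reindex_inj (can_inj (hK s^-1%g))); apply: eq_bigr => m _.
rewrite !mcoeff_sym; congr (p@__ * q@__); rewrite hE //.
by apply/mnmP => i; rewrite !mnmE permK.
Qed.

Lemma ip_sym k e c p q : ip k (sym e c p) q = ip k p (sym e c q).
Proof.
rewrite ipC /sym !linear_sum (reindex_inj invg_inj); apply: eq_big => s.
  by rewrite stabV.
by move=> _; rewrite !linearZ /= chiV ipC ip_msym invgK.
Qed.

Lemma ip_eq0 k p : (msize p <= k)%N -> ip k p p = 0 -> p = 0.
Proof.
move=> pk /eqP; rewrite psumr_eq0 => [|m _]; last exact: sqr_ge0.
move=> /allP p0; apply/mpolyP => m; rewrite mcoeff0.
have [mk|] := ltnP (mdeg m) k; last first.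
  move=> km; apply/eqP; rewrite mcoeff_eq0; apply/negP => /msize_mdeg_lt.
  by rewrite ltnNge (leq_trans pk).
have /= := p0 (BMultinom mk); rewrite mem_index_enum mulf_eq0 orbb => /(_ isT).
by move/eqP.
Qed.

Lemma ipX k (m : 'X_{1..n}) p : (mdeg m < k)%N -> ip k 'X_[m] p = p@_m.
Proof.
move=> mk; rewrite /ip (bigD1 (BMultinom mk)) //= mcoeffX eqxx mul1r big1 ?addr0 //.
move=> m' m'm; rewrite mcoeffX -[m == _]/(val (BMultinom mk) == val m').
by rewrite val_eqE eq_sym (negPf m'm) mul0r.
Qed.

Lemma mcoeff_msize p (m : 'X_{1..n}) : (msize p <= mdeg m)%N -> p@_m = 0.
Proof.
move=> pm; apply/eqP; rewrite mcoeff_eq0; apply/negP => /msize_mdeg_lt.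
by rewrite ltnNge pm.
Qed.

Lemma msize_leP k p :
  (forall m : 'X_{1..n}, (k <= mdeg m)%N -> p@_m = 0) -> (msize p <= k)%N.
Proof.
move=> pk; rewrite mmeasureE; apply/bigmax_leqP_seq => m mp _ /=.
rewrite ltnNge; apply/negP => /pk/eqP.
by rewrite mcoeff_eq0 mp.
Qed.

Lemma msize_sym e c p : (msize (sym e c p) <= msize p)%N.
Proof.
apply: msize_leP => m pm; rewrite /sym linear_sum big1 // => s _.
by rewrite [LHS]mcoeffZ mcoeff_sym mcoeff_msize ?mulr0 // mdeg_mperm.
Qed.

End Symmetrizers.

(** * The sum of all transpositions on an extremal symmetrizer *)

Section Casimir.
Variable n : nat.
Implicit Types (c : 'I_n -> 'I_n) (s t g : 'S_n) (p q u : {mpoly rat[n]}).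

Definition fib c i : nat := #|[set x | c x == i]|.

Lemma sum_fib c : (\sum_i fib c i)%N = n.
Proof.
rewrite -[RHS](card_ord n) -sum1_card [RHS](partition_big c predT) //=.
by apply: eq_bigr => i _; rewrite sum1dep_card.
Qed.

(** The number of ordered pairs of equally colored elements; extremal colorings maximize it. *)
Definition qstat c : nat := \sum_i fib c i ^ 2.

Lemma fib_perm c s i : fib (c \o s) i = fib c i.
Proof.
rewrite /fib -[RHS](card_preimset _ (@perm_inj _ s)).
by apply: eq_card => x; rewrite !inE.
Qed.

Lemma qstat_perm c s : qstat (c \o s) = qstat c.
Proof. by apply: eq_bigr => i _; rewrite fib_perm. Qed.

Definition recolor c y i : 'I_n -> 'I_n := fun x => if x == y then i else c x.

(** Moving an element from a class of size b into another of size a >= b raises the sum of squares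
    by 2(a - b) + 2. *)
Lemma qstat_recolor c y i :
  c y != i -> (fib c (c y) <= fib c i)%N -> (qstat c < qstat (recolor c y i))%N.
Proof.
move=> cyi le_f.
have fi : fib (recolor c y i) i = (fib c i).+1.
  rewrite /fib (cardsD1 y) inE /recolor eqxx eqxx add1n; congr _.+1.
  apply: eq_card => x; rewrite !inE; case: (eqVneq x y) => //= ->.
  by rewrite (negPf cyi).
have fj : (fib (recolor c y i) (c y)).+1 = fib c (c y).
  rewrite [in RHS]/fib [in RHS](cardsD1 y) inE eqxx add1n; congr _.+1.
  apply: eq_card => x; rewrite !inE /recolor; case: (eqVneq x y) => //= _.
  by rewrite eq_sym (negPf cyi).
have fk k : k != i -> k != c y -> fib (recolor c y i) k = fib c k.
  move=> ki kc; apply: eq_card => x; rewrite !inE /recolor.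
  by case: (eqVneq x y) => // ->; rewrite ![_ == k]eq_sym (negPf ki) (negPf kc).
rewrite /qstat (bigD1 i) //= (bigD1 (c y)) //= [ltnRHS](bigD1 i) //=.
rewrite [in ltnRHS](bigD1 (c y)) //= fi.
rewrite [in ltnRHS](eq_bigr (fun k => fib c k ^ 2)%N); last first.
  by move=> k /andP[ki kc]; rewrite fk.
rewrite !addnA ltn_add2r; move: fj le_f => <-.
by move: (fib _ _) (fib _ _) => a b; rewrite -!mulnn; nia.
Qed.

(** The stabilizer of the recoloring splits into cosets according to the image z of [y], with
    representatives [tperm z y]. The subgroup fixing [y] lies in [stab c], hence acts on [u] by
    [chi e], and all cosets carry the same factor [N]. The term z = y gives [u]; the other z are the
    elements of color [i]. *)
Lemma raise e c y i u : c y != i ->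
    (forall s, stab c s -> msym s u = chi e s *: u) ->
    sym e (recolor c y i) u = 0 ->
  \sum_(x | c x == i) (-1) ^+ e *: msym (tperm x y) u = - u.
Proof.
move=> cyi inv; set c' := recolor c y i.
pose N := #|[pred h | stab c' h && (h y == y)]|.
have c'y : c' y = i by rewrite /c' /recolor eqxx.
have part z : c' z == i ->
    \sum_(s | stab c' s && (s y == z)) chi e s *: msym s u =
    N%:R *: (chi e (tperm z y) *: msym (tperm z y) u).
  move=> /eqP c'z; rewrite (reindex_inj (mulIg (tperm z y))) /=.
  have st : stab c' (tperm z y) by apply: stab_tperm; rewrite c'z.
  rewrite (eq_big [pred h | stab c' h && (h y == y)]
                  (fun=> chi e (tperm z y) *: msym (tperm z y) u)).
  - by rewrite sumr_const scaler_nat.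
  - move=> h /=; rewrite stabMr // permM; congr (_ && _).
    by rewrite -{2}(tpermR z y) (inj_eq perm_inj).
  move=> h /andP[]; rewrite stabMr // permM => hs /eqP hy.
  have hy' : h y = y by apply: (@perm_inj _ (tperm z y)); rewrite hy tpermR.
  rewrite msymMm inv; last first.
    apply/stabP => x; have [->|xy] := eqVneq x y; first by rewrite hy'.
    move/stabP: hs => /(_ x); rewrite /c' /recolor (negPf xy).
    by rewrite -{1}hy' (inj_eq perm_inj) (negPf xy).
  by rewrite linearZ /= scalerA chiM mulrAC chi2 mul1r.
rewrite /sym (partition_big (fun s : 'S_n => s y) (fun z => c' z == i)); last first.
  by move=> s /stabP/(_ y) ->; rewrite c'y.
rewrite (eq_bigr _ part) => /eqP; rewrite -[X in X == 0]scaler_sumr scaler_eq0 => /orP[].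
  rewrite pnatr_eq0 => /eqP N0.
  suff : (0 < N)%N by rewrite N0.
  by apply/card_gt0P; exists 1%g; rewrite inE stab1 perm1 eqxx.
rewrite (bigD1 y) ?c'y //= tperm1 chi1 scale1r msym1m addrC addr_eq0 => /eqP <-.
apply: eq_big => x.
  rewrite /c' /recolor; case: (eqVneq x y) => [->|]; last by rewrite andbT.
  by rewrite (negPf cyi) andbF.
move=> /eqP cxi; rewrite chi_tperm //.
by apply: contraNneq cyi => <-; rewrite cxi.
Qed.

(** Pairs are ordered and x = y is allowed, so this is n times the identity plus twice the sum of
    all transpositions. *)
Definition casimir p : {mpoly rat[n]} := \sum_x \sum_y msym (tperm x y) p.

Lemma casimir_is_linear : linear casimir.
Proof.
move=> a p q; rewrite /casimir scaler_sumr -big_split; apply: eq_bigr => x _ /=.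
by rewrite scaler_sumr -big_split; apply: eq_bigr => y _; rewrite linearP.
Qed.

HB.instance Definition _ :=
  GRing.isLinear.Build rat {mpoly rat[n]} {mpoly rat[n]} _ casimir
    casimir_is_linear.

Lemma casimir_msym s p : casimir (msym s p) = msym s (casimir p).
Proof.
rewrite /casimir linear_sum (reindex_inj (@perm_inj _ s)); apply: eq_bigr => x _.
rewrite linear_sum (reindex_inj (@perm_inj _ s)); apply: eq_bigr => y _ /=.
by rewrite -!msymMm -tpermJ conjgE !mulgA mulgV mul1g.
Qed.

Lemma casimir_sym e c p : casimir (sym e c p) = sym e c (casimir p).
Proof.
rewrite {1}/sym linear_sum; apply: eq_bigr => s _.
by rewrite linearZ /= casimir_msym.
Qed.

Definition mins c : nat := \sum_i \sum_(j | j != i) minn (fib c i) (fib c j).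

(** Twice the sum of the contents (column minus row) of the Ferrers diagram whose row lengths are
    the fibre sizes in decreasing order. *)
Definition kappa c : rat := (qstat c)%:R - n%:R - (mins c)%:R.

(** Transpositions are grouped by the colors of their two entries. Inside a fibre they act by the
    character; between two fibres, [raise] evaluates the sum over the larger fibre for each element
    of the smaller one, whence the minimum in [mins]. *)
Lemma casimir_eigen e c u :
    (forall s, stab c s -> msym s u = chi e s *: u) ->
    (forall y i, c y != i -> (fib c (c y) <= fib c i)%N ->
       sym e (recolor c y i) u = 0) ->
  casimir u = (n%:R + (-1) ^+ e * kappa c) *: u.
Proof.
move=> inv rec; set E := (-1) ^+ e.
have EE : E * E = 1 by rewrite -signr_addb addbb.
(* Scalar of the block of pairs with colors [i] and [j]; on the diagonal, the [fib c i] pairs with x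
   = y act as the identity and the others by [E]. *)
pose A i j : rat := if j == i then (fib c i)%:R + E * ((fib c i)%:R ^+ 2 - (fib c i)%:R)
                    else - E * (minn (fib c i) (fib c j))%:R.
have blk_lt i j : j != i -> (fib c j <= fib c i)%N ->
    \sum_(x | c x == i) \sum_(y | c y == j) msym (tperm x y) u = A i j *: u.
  move=> ji le_f; rewrite exchange_big /= (eq_bigr (fun=> - E *: u)).
    rewrite sumr_const /A (negPf ji) (minn_idPr le_f) -scaler_nat scalerA mulrC.
    by congr (_ * _%:R *: _); apply: eq_card => x; rewrite !inE.
  move=> y /eqP cy; have := @raise e c y i u; rewrite cy ji => /(_ isT inv).
  rewrite rec ?cy // => /(_ erefl); rewrite -scaler_sumr -/E => r.
  by rewrite -[LHS]scale1r -EE -scalerA r scalerN scaleNr.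
have blk i j :
    \sum_(x | c x == i) \sum_(y | c y == j) msym (tperm x y) u = A i j *: u.
  have [->|ji] := eqVneq j i; last first.
    have [/blk_lt->//|/ltnW/blk_lt] := leqP (fib c j) (fib c i).
    have -> : A i j = A j i by rewrite /A minnC [i == j]eq_sym (negPf ji).
    rewrite eq_sym => /(_ ji) <-.
    rewrite exchange_big; apply: eq_bigr => x _; apply: eq_bigr => y _.
    by rewrite tpermC.
  rewrite (eq_bigr (fun=> (1 + E * ((fib c i)%:R - 1)) *: u)).
    rewrite sumr_const -scaler_nat scalerA /A eqxx.
    have -> : #|(fun x => c x == i)| = fib c i.
      by rewrite /fib; apply: eq_card => x; rewrite !inE.
    by congr (_ *: _); ring.
  move=> x cx; rewrite (bigD1 x) //= tperm1 msym1m scalerDl scale1r; congr (_ + _).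
  rewrite (eq_bigr (fun=> E *: u)).
    have -> : (fib c i)%:R - 1 = #|[pred y | (c y == i) && (y != x)]|%:R :> rat.
      apply/eqP; rewrite subr_eq natr1 eqr_nat /fib (cardsD1 x) inE cx add1n.
      by rewrite eqSS; apply/eqP/eq_card => y; rewrite !inE andbC.
    by rewrite sumr_const mulrC -scalerA scaler_nat.
  move=> y /andP[cy yx]; rewrite inv ?chi_tperm 1?eq_sym //.
  by apply: stab_tperm; rewrite (eqP cx) (eqP cy).
rewrite /casimir (partition_big c predT) //=.
transitivity (\sum_i \sum_j A i j *: u).
  apply: eq_bigr => i _; under eq_bigr do rewrite (partition_big c predT) //=.
  by rewrite exchange_big /=; apply: eq_bigr => j _; exact: blk.
under eq_bigr do rewrite -scaler_suml.
rewrite -scaler_suml; congr (_ *: _).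
under eq_bigr => i _.
  rewrite (bigD1 i) //= {1}/A eqxx.
  under eq_bigr => j /negPf ji do rewrite /A ji.
  rewrite -mulr_sumr -natr_sum; over.
rewrite !big_split /= -natr_sum sum_fib -!mulr_sumr sumrB -!natr_sum sum_fib.
rewrite -/(mins c) /kappa /qstat natr_sum.
under [in RHS]eq_bigr do rewrite natrX.
by ring.
Qed.

Lemma sym_id e p : sym e id p = p.
Proof.
rewrite /sym (big_pred1 1%g) ?chi1 ?scale1r ?msym1m // => s.
apply/stabP/eqP => [s1|-> x]; last by rewrite perm1.
by apply/permP => x; rewrite s1 perm1.
Qed.

Lemma max_coloring e w : w != 0 -> exists c : 'I_n -> 'I_n,
  sym e c w != 0 /\ forall c', (qstat c < qstat c')%N -> sym e c' w = 0.
Proof.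
move=> w0; have ffK (c : 'I_n -> 'I_n) : sym e (finfun c) w = sym e c w.
  by apply: eq_stab_sym => s; apply: eq_forallb => x; rewrite !ffunE.
(* The identity coloring has trivial stabilizer, so the maximum is taken over a nonempty set. *)
have i0 : sym e ([ffun x => x] : {ffun 'I_n -> 'I_n}) w != 0 by rewrite ffK sym_id.
case: (@arg_maxnP _ _ (fun c : {ffun 'I_n -> 'I_n} => sym e c w != 0)
         (fun c : {ffun 'I_n -> 'I_n} => qstat c) i0) => c cw cmax.
exists c; split=> // c' cc'; apply/eqP; rewrite -ffK; apply: contraTT cc' => c'w.
rewrite -leqNgt; apply: leq_trans (cmax _ c'w); apply/eq_leq/eq_bigr => i _.
by congr (_ ^ 2)%N; apply: eq_card => x; rewrite !inE ffunE.
Qed.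

(** A recoloring d of [c] into a class at least as large must kill [sym e c w]. Expanding this
    vector, each term becomes a translate of [sym e (d \o s) w], and d composed with [s] has the
    same [qstat] as d, above that of [c]. *)
Lemma max_coloring_eigen e c w :
    (forall c', (qstat c < qstat c')%N -> sym e c' w = 0) ->
  casimir (sym e c w) = (n%:R + (-1) ^+ e * kappa c) *: sym e c w.
Proof.
move=> cmax; apply: casimir_eigen => [s|y i ci le_f]; first exact: sym_stabl.
rewrite {2}/sym linear_sum big1 // => s _; rewrite linearZ /= -symJ.
rewrite cmax ?linear0 ?scaler0 //.
by rewrite (leq_trans (qstat_recolor ci le_f)) //; apply/eq_leq/esym/qstat_perm.
Qed.

End Casimir.

(** * Numberings and Ferrers arrangements *)

Lemma eq_of_leq_sum (I : finType) (P : pred I) (F G : I -> nat) :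
    (forall i, P i -> F i <= G i)%N ->
    (\sum_(i | P i) G i <= \sum_(i | P i) F i)%N ->
  forall i, P i -> F i = G i.
Proof.
move=> FG GF; have [_ eqE] : (\sum_(i | P i) F i <= \sum_(i | P i) G i
    ?= iff [forall (i | P i), F i == G i])%N.
  by apply: leqif_sum => i /FG.
have /forall_inP H : [forall (i | P i), F i == G i].
  by rewrite -eqE eqn_leq leq_sum.
by move=> i /H/eqP.
Qed.

Section Numberings.
Variables (n : nat) (la : intpart n).
Implicit Types (T : numbering la) (p : {mpoly rat[n]}).

Definition rowf T x : 'I_n := box_row (box_of T x).
Definition colf T x : 'I_n := box_col (box_of T x).

Lemma box_ofK T : cancel (box_of T) (val T).
Proof. by move=> x; rewrite /box_of f_iinv. Qed.

Lemma numberingK T : cancel (val T) (box_of T).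
Proof.
by move=> b; have /andP[/injectiveP Tinj _] := valP T; apply: Tinj; rewrite box_ofK.
Qed.

Lemma box_eq (b b' : box la) : box_row b = box_row b' -> box_col b = box_col b' -> b = b'.
Proof.
by case: b b' => [[i j] ?] [[i' j'] ?] /= ii jj; apply/val_inj; congr pair.
Qed.

Lemma rc_inj T x y : rowf T x = rowf T y -> colf T x = colf T y -> x = y.
Proof. by move=> rr cc; apply: (can_inj (box_ofK T)); apply: box_eq. Qed.

Lemma row_stabE T s : (s \in row_stab T) = stab (rowf T) s.
Proof.
have eE r : row_entries T r = [set x | rowf T x == r].
  apply/setP => x; rewrite inE; apply/imsetP/idP => [[b br ->]|xr].
    by rewrite /rowf numberingK; rewrite inE in br.
  by exists (box_of T x); rewrite ?inE ?box_ofK.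
rewrite inE; apply/forallP/stabP => [sr x | sr i].
  have /eqP/setP/(_ (s x)) := sr (rowf T x).
  by rewrite !eE mem_imset ?inE ?eqxx => [/esym/eqP|]; last exact: perm_inj.
rewrite eE eqEcard card_imset ?leqnn ?andbT; last exact: perm_inj.
by apply/subsetP => _ /imsetP[x xr ->]; rewrite !inE in xr *; rewrite sr.
Qed.

Lemma col_stabE T s : (s \in col_stab T) = stab (colf T) s.
Proof.
have eE r : col_entries T r = [set x | colf T x == r].
  apply/setP => x; rewrite inE; apply/imsetP/idP => [[b br ->]|xr].
    by rewrite /colf numberingK; rewrite inE in br.
  by exists (box_of T x); rewrite ?inE ?box_ofK.
rewrite inE; apply/forallP/stabP => [sr x | sr i].
  have /eqP/setP/(_ (s x)) := sr (colf T x).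
  by rewrite !eE mem_imset ?inE ?eqxx => [/esym/eqP|]; last exact: perm_inj.
rewrite eE eqEcard card_imset ?leqnn ?andbT; last exact: perm_inj.
by apply/subsetP => _ /imsetP[x xr ->]; rewrite !inE in xr *; rewrite sr.
Qed.

Lemma young_symmE T p :
  young_symm T p = sym true (colf T) (sym false (rowf T) p).
Proof.
rewrite /young_symm; apply: eq_big => [s|s _]; first exact: col_stabE.
rewrite /sym (linear_sum (msym s)) scaler_sumr; apply: eq_big => [t|t _]; first exact: row_stabE.
by rewrite chi_false scale1r.
Qed.

Lemma intpart_sumn : sumn (val la) = n.
Proof. by have /and3P[_ _ /eqP] := valP la. Qed.

Lemma intpart_size : (size (val la) <= n)%N.
Proof.
have /and3P[_ + /eqP la_n] := valP la.
suff le_size (l : seq nat) : all (leq 1) l -> (size l <= sumn l)%N.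
  by move/le_size; rewrite [sumn _]la_n.
by elim: l => //= a l IH /andP[a1 /IH]; lia.
Qed.

Lemma nth_leq_sumn (l : seq nat) i : (nth 0 l i <= sumn l)%N.
Proof.
by elim: l i => [|a l IH] [|i] //=; [exact: leq_addr | rewrite (leq_trans (IH i)) ?leq_addl].
Qed.

Lemma sumn_nth (l : seq nat) k : (size l <= k)%N -> (\sum_(i < k) nth 0 l i)%N = sumn l.
Proof.
elim: l k => [|a l IH] k /= lk; first by rewrite big1 // => i _; rewrite nth_nil.
by case: k lk => // k lk; rewrite big_ord_recl /= IH.
Qed.

Lemma card_box : #|{: box la}| = n.
Proof.
rewrite card_sub -[RHS]intpart_sumn -(sumn_nth intpart_size).
rewrite -sum1_card -(pair_big_dep predT
  (fun i j : 'I_n => (j < nth 0 (val la) i)%N) (fun _ _ => 1%N)) /=.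
apply: eq_bigr => i _.
have le_n : (nth 0 (val la) i <= n)%N by rewrite -[leqRHS]intpart_sumn nth_leq_sumn.
by rewrite (big_ord_narrow le_n) sum1_card card_ord.
Qed.

Lemma numbering_of (f : 'I_n -> box la) : injective f ->
  exists T : numbering la, forall x, box_of T x = f x.
Proof.
move=> f_inj; have [g fK gK] : bijective f.
  by apply: inj_card_bij; rewrite // card_ord card_box.
have gnum : is_numbering [ffun b => g b].
  apply/andP; split.
    by apply/injectiveP => b b'; rewrite !ffunE => /(can_inj gK).
  by apply/forallP => i; apply/codomP; exists (f i); rewrite ffunE fK.
exists (exist (fun T : {ffun box la -> _} => is_true (is_numbering T)) _ gnum) => x.
by apply: (canLR (numberingK _)); rewrite /= ffunE fK.
Qed.

End Numberings.

(** * Pairs of colorings whose classes meet in at most one element *)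

Section Ferrers.
Variables (n : nat) (r c : 'I_n -> 'I_n).
Hypothesis rc_inj : forall x y, r x = r y -> c x = c y -> x = y.

Let K i j : {set 'I_n * 'I_n} :=
  [set p | [&& c p.1 == i, c p.2 == j & r p.1 == r p.2]].

(** The first entry of a pair fixes the [r]-class of the second, whose [c]-class is [j]; by [rc_inj]
    it determines the pair. *)
Lemma coincidence_fst i j :
  [set p.1 | p in K i j] \subset [set x | c x == i] /\
  #|[set p.1 | p in K i j]| = #|K i j|.
Proof.
split; first by apply/subsetP => _ /imsetP[p + ->]; rewrite !inE => /andP[].
apply: card_in_imset => -[x y] [x' y'] /=; rewrite !inE /=.
move=> /and3P[/eqP cx /eqP cy /eqP r1] /and3P[/eqP cx' /eqP cy' /eqP r2] xx.
by congr pair => //; apply: rc_inj; rewrite ?cy ?cy' // -r1 -r2 xx.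
Qed.

Lemma coincidence_sym i j : #|K i j| = #|K j i|.
Proof.
have swapK : involutive (fun p : 'I_n * 'I_n => (p.2, p.1)) by case.
rewrite -(card_imset _ (inv_inj swapK)); apply: eq_card => -[x y].
apply/imsetP/idP => [[[x' y']]|]; rewrite !inE /=.
  by move=> /and3P[? ? /eqP rr] [-> ->]; rewrite rr; apply/and3P; split.
by move=> /and3P[? ? /eqP rr]; exists (y, x) => //; rewrite inE /= rr; apply/and3P; split.
Qed.

Lemma coincidence_le i j : (#|K i j| <= minn (fib c i) (fib c j))%N.
Proof.
have le_fst i' j' : (#|K i' j'| <= fib c i')%N.
  by have [/subset_leq_card + <-] := coincidence_fst i' j'.
by rewrite leq_min le_fst coincidence_sym le_fst.
Qed.

(** Double count of the ordered pairs in a common [r]-class. Sorted by their [c]-classes, the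
    diagonal ones are the n pairs with x = y. *)
Lemma sum_coincidence : (n + \sum_i \sum_(j | j != i) #|K i j| = qstat r)%N.
Proof.
have Kd i : #|K i i| = fib c i.
  have [sub <-] := coincidence_fst i i; apply/eqP; rewrite eqn_leq subset_leq_card //.
  apply/subset_leq_card/subsetP => x; rewrite !inE => cx.
  by apply/imsetP; exists (x, x) => //; rewrite inE /= cx eqxx.
rewrite -{1}(sum_fib c) -big_split /=.
transitivity (\sum_i \sum_j #|K i j|)%N.
  by apply: eq_bigr => i _; rewrite [RHS](bigD1 i) //= Kd.
transitivity #|[set p : 'I_n * 'I_n | r p.1 == r p.2]|.
  rewrite -sum1_card (partition_big (fun p => c p.1) predT) //=.
  apply: eq_bigr => i _; rewrite (partition_big (fun p => c p.2) predT) //=.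
  apply: eq_bigr => j _; rewrite -sum1_card; apply: eq_bigl => p.
  by rewrite !inE; case: (r _ == _); case: (_ == i); case: (_ == j).
rewrite -sum1_card (partition_big (fun p => r p.1) predT) //=.
apply: eq_bigr => i _.
rewrite (eq_bigl (fun p => (r p.1 == i) && (r p.2 == i))); last first.
  move=> p; rewrite inE andbC; case: eqP => //= ->; exact: eq_sym.
rewrite -(pair_big (fun x => r x == i) (fun x => r x == i) (fun _ _ => 1%N)) /=.
by rewrite sum1dep_card sum_nat_cond_const -/(fib r i) mulnn.
Qed.

Lemma qstat_le : (qstat r <= mins c + n)%N.
Proof.
rewrite -sum_coincidence addnC leq_add2r.
by apply: leq_sum => i _; apply: leq_sum => j _; exact: coincidence_le.
Qed.

(** Equality in [qstat_le] makes every bound of [coincidence_le] an equality, so each element of the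
    smaller of two [c]-classes has a partner in the other. *)
Lemma column_filled : qstat r = (mins c + n)%N ->
  forall x j, (fib c (c x) <= fib c j)%N -> exists2 y, c y = j & r y = r x.
Proof.
move=> eqQ x j le_f; have [->|jx] := eqVneq j (c x); first by exists x.
have sumE : (\sum_i \sum_(j | j != i) minn (fib c i) (fib c j)
              <= \sum_i \sum_(j | j != i) #|K i j|)%N.
  by rewrite -(leq_add2l n) sum_coincidence eqQ addnC.
have Ei := eq_of_leq_sum _ sumE (i := c x) isT.
have /eq_of_leq_sum Ej : (\sum_(j | j != c x) minn (fib c (c x)) (fib c j)
    <= \sum_(j | j != c x) #|K (c x) j|)%N.
  rewrite Ei // => i _; apply: leq_sum => k _; exact: coincidence_le.
have := Ej (fun k _ => coincidence_le _ k) j jx.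
rewrite (minn_idPl le_f); have [sub <-] := coincidence_fst (c x) j => cardE.
have /setP/(_ x) : [set p.1 | p in K (c x) j] = [set y | c y == c x].
  by apply/eqP; rewrite eqEcard sub /= cardE leqnn.
rewrite inE eqxx => /imsetP[[x' y]]; rewrite inE /=.
by move=> /and3P[_ /eqP cy /eqP rr] ->; exists y.
Qed.

End Ferrers.

(** * Sorting colors by fibre size into a partition *)

Section Ranking.
Variables (n : nat) (c : 'I_n -> 'I_n).

Definition by_fib : seq 'I_n := sort (fun i j => fib c j <= fib c i)%N (enum 'I_n).

Lemma mem_by_fib i : i \in by_fib.
Proof. by rewrite mem_sort mem_enum. Qed.

Lemma size_by_fib : size by_fib = n.
Proof. by rewrite size_sort size_enum_ord. Qed.

Lemma index_by_fib_lt i : (index i by_fib < n)%N.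
Proof. by rewrite -[ltnRHS]size_by_fib index_mem mem_by_fib. Qed.

Definition rank i : 'I_n := Ordinal (index_by_fib_lt i).

Lemma rank_inj : injective rank.
Proof.
move=> i j /(congr1 val) /= ij; have := nth_index i (mem_by_fib i).
by rewrite ij nth_index ?mem_by_fib.
Qed.

Lemma sorted_by_fib : sorted geq [seq fib c i | i <- by_fib].
Proof. by rewrite sorted_map; apply: sort_sorted => i j; exact: leq_total. Qed.

(** Empty fibres are dropped, the parts of a partition being positive; lookups with default 0 do not
    see the difference. *)
Definition fib_shape : seq nat := [seq k <- [seq fib c i | i <- by_fib] | (1 <= k)%N].

Lemma fib_shape_intpart : is_intpart n fib_shape.
Proof.
have geq_trans : transitive geq by move=> a b d /= ba ad; exact: leq_trans ad ba.
apply/and3P; split; first exact: (sorted_filter geq_trans _ sorted_by_fib).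
  exact: filter_all.
rewrite -[X in _ == X](sum_fib c) -(big_enum _ _ _ (fib c)) /=.
have /(perm_big _) <- : perm_eq by_fib (enum 'I_n) by rewrite perm_sort.
rewrite -(big_map (fib c) predT id) -sumnE /fib_shape.
by elim: [seq _ | _ <- _] => //= -[|k] l /eqP IH /=; rewrite IH.
Qed.

Lemma nth_sorted_pos (l : seq nat) i :
  sorted geq l -> nth 0 [seq k <- l | (1 <= k)%N] i = nth 0 l i.
Proof.
elim: l i => // a l IH i /= al.
have geq_trans : transitive geq by move=> x y d /= yx xd; exact: leq_trans xd yx.
case: a al => [|a] al; last by case: i => //= i; apply/IH/(path_sorted al).
have /all_pred1P -> : all (pred1 0) l.
  move: al; rewrite (path_sortedE geq_trans) => /andP[/allP l0 _].
  by apply/allP => x /l0 /=; rewrite leqn0.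
rewrite filter_nseq nth_nil -[0 :: _]/(nseq (size l).+1 0) nth_nseq.
by case: ifP.
Qed.

Lemma nth_shape i : nth 0 fib_shape (rank i) = fib c i.
Proof.
rewrite nth_sorted_pos ?sorted_by_fib // (nth_map i) ?size_by_fib ?index_by_fib_lt //.
by rewrite nth_index ?mem_by_fib.
Qed.

Lemma rank_le i j : (rank j <= rank i)%N -> (fib c i <= fib c j)%N.
Proof.
move=> ji; rewrite -(nth_index i (mem_by_fib i)) -(nth_index i (mem_by_fib j)).
have le_trans : transitive (fun i j => fib c j <= fib c i)%N.
  by move=> x y d /= yx xd; exact: leq_trans xd yx.
apply: (sorted_leq_nth le_trans) => //; rewrite ?inE ?size_by_fib ?index_by_fib_lt //.
by apply: sort_sorted => x y; exact: leq_total.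
Qed.

End Ranking.

(** Each x goes to the box given by the ranks of [r x] and [c x], classes being ranked by decreasing
    size. Ranking is injective, so the stabilizers are unchanged. *)
Lemma numbering_of_colorings n (r c : 'I_n -> 'I_n) :
    (forall x y, r x = r y -> c x = c y -> x = y) ->
    (forall x j, (fib c (c x) <= fib c j)%N -> exists2 y, c y = j & r y = r x) ->
  exists (la : intpart n) (T : numbering la),
    (forall s, stab (rowf T) s = stab r s) /\ (forall s, stab (colf T) s = stab c s).
Proof.
move=> rc_inj filled.
pose la : intpart n := exist (fun l => is_true (is_intpart n l)) _ (fib_shape_intpart r).
have in_shape x : (rank c (c x) < nth 0 (fib_shape r) (rank r (r x)))%N.
  rewrite nth_shape.
  (* The columns ranked up to that of [x] are at least as large as it, so by [filled] each of them
     meets the row of [x]. *)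
  pose A := [set j in take (rank c (c x)).+1 (by_fib c)].
  have cardA : #|A| = (rank c (c x)).+1.
    rewrite cardsE; have /card_uniqP -> : uniq (take (rank c (c x)).+1 (by_fib c)).
      by rewrite take_uniq // sort_uniq enum_uniq.
    by rewrite size_takel // size_by_fib index_by_fib_lt.
  rewrite -cardA; apply: leq_trans (leq_imset_card c _); apply: subset_leq_card.
  apply/subsetP => j; rewrite inE => jA.
  have [|y <- ry] := filled x j; last by apply: imset_f; rewrite inE ry.
  by apply: rank_le; rewrite /= -ltnS -in_take ?mem_by_fib.
pose f x : box la :=
  exist (fun b : 'I_n * 'I_n => is_true (b.2 < nth 0 (val la) b.1)%N)
    (rank r (r x), rank c (c x)) (in_shape x).
have f_inj : injective f.
  move=> x y /(congr1 val) E.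
  have /rank_inj rr : rank r (r x) = rank r (r y) := congr1 fst E.
  have /rank_inj cc : rank c (c x) = rank c (c y) := congr1 snd E.
  exact: rc_inj.
have [T TE] := numbering_of f_inj.
exists la, T; split=> s; apply/stabP/stabP => st x; move: (st x);
  rewrite /rowf /colf !TE /box_row /box_col /=.
- exact: rank_inj.
- by move->.
- exact: rank_inj.
- by move->.
Qed.

(* The second coloring is chosen for the vector produced by the first, on which
   the Casimir element already acts as a scalar: hence both see the same
   eigenvalue. *)
Lemma young_dual_nonzero n (w : {mpoly rat[n]}) : w != 0 ->
  exists (la : intpart n) (T : numbering la),
    sym false (rowf T) (sym true (colf T) w) != 0.
Proof.
move=> w0; have [c [u0 cmax]] := max_coloring true w0.
have [r [v0 rmax]] := max_coloring false u0.
set u := sym true c w in u0 v0 rmax; set v := sym false r u in v0.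
have Eu := max_coloring_eigen cmax; have := max_coloring_eigen rmax.
rewrite casimir_sym (Eu : casimir u = _) linearZ /= -/v => /eqP.
rewrite -subr_eq0 -scalerBl scaler_eq0 (negPf v0) orbF expr0 expr1 => /eqP E.
have kk : kappa c + kappa r = 0 by rewrite -[LHS]opprK -oppr0 -E; ring.
have rc_inj x y : r x = r y -> c x = c y -> x = y.
  (* The transposition of [x] and [y] would negate [u] while being absorbed by the row symmetrizer,
     making [v] zero. *)
  move=> rxy cxy; apply/eqP; apply: contraNT v0 => xy; apply/eqP.
  apply: (sym_eq0 (stab_tperm rxy)).
  by rewrite sym_stabl ?stab_tperm // !chi_tperm.
have [la [T [Tr Tc]]] : exists (la : intpart n) (T : numbering la),
    (forall s, stab (rowf T) s = stab r s) /\ (forall s, stab (colf T) s = stab c s).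
  apply: numbering_of_colorings => //; apply: column_filled => //.
  (* The two inequalities sum to an equality because [kappa c + kappa r = 0], so each is an
     equality. *)
  have le1 := qstat_le rc_inj.
  have le2 := qstat_le (fun x y cc rr => rc_inj x y rr cc).
  have : (qstat c + qstat r = mins c + mins r + n + n)%N.
    apply/eqP; rewrite -(eqr_nat rat) !natrD -subr_eq0 -kk /kappa; apply/eqP; ring.
  by lia.
by exists la, T; rewrite (eq_stab_sym _ _ Tr) (eq_stab_sym _ _ Tc).
Qed.

(** * Straightening *)

(** Rearrangement: the swap gains (f y - f x)(g x - g y). *)
Lemma sum_swap_lt (I : finType) (f g : I -> nat) (x y : I) :
    (f x < f y)%N -> (g y < g x)%N ->
  (\sum_k f k * g k < \sum_k f k * g (tperm x y k))%N.
Proof.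
move=> fxy gyx; have yx : y != x by apply: contraTneq fxy => ->; rewrite ltnn.
rewrite (bigD1 x) // (bigD1 y) //= [ltnRHS](bigD1 x) // [in ltnRHS](bigD1 y) //=.
rewrite tpermL tpermR [in ltnRHS](eq_bigr (fun k => f k * g k)%N); last first.
  by move=> k /andP[kx ky]; rewrite tpermD // eq_sym.
by rewrite !addnA ltn_add2r; nia.
Qed.

Section Straightening.
Variables (n : nat) (la : intpart n) (T : numbering la).
Local Notation r := (rowf T).
Local Notation c := (colf T).
Implicit Types (m : 'X_{1..n}) (s t : 'S_n) (z w : {mpoly rat[n]}) (i j q : 'I_n).
Local Notation "m # s" := [multinom (m : 'X_{1..n}) (s i) | i < n]
  (at level 40, left associativity).

Lemma col_lt x : (c x < nth 0 (val la) (r x))%N.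
Proof. by rewrite /colf /rowf /box_col /box_row; case: (box_of T x). Qed.

Lemma nth_intpart_le a b : (a <= b)%N -> (nth 0 (val la) b <= nth 0 (val la) a)%N.
Proof.
move=> ab; have /and3P[sla _ _] := valP la.
have [bs|bs] := ltnP b (size (val la)); last by rewrite [leqLHS]nth_default.
have geq_trans : transitive geq by move=> x y d /= yx xd; exact: leq_trans xd yx.
by apply: (sorted_leq_nth geq_trans) => //; [exact: leqnn | exact: leq_ltn_trans bs].
Qed.

Lemma ex_entry i j : (j < nth 0 (val la) i)%N -> exists2 x, r x = i & c x = j.
Proof.
move=> ij.
pose b : box la := exist (fun b : 'I_n * 'I_n => is_true (b.2 < nth 0 (val la) b.1)%N) (i, j) ij.
by exists (val T b); rewrite /rowf /colf numberingK.
Qed.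

(** For i < j, [tail i q] and [init j q] together form a Garnir set: the end of row i and the
    beginning of row j, both including column q. *)
Definition tail i q : {set 'I_n} := [set x | (r x == i) && (q <= c x)%N].
Definition init j q : {set 'I_n} := [set x | (r x == j) && (c x <= q)%N].

(* The stabilizer of this coloring is the symmetric group of Z, if x0 is in Z. *)
Definition collapse (Z : {set 'I_n}) x0 : 'I_n -> 'I_n :=
  fun x => if x \in Z then x0 else x.

(** The two column ranges cover the columns of row [i] and overlap exactly in [q]. *)
Lemma card_tail_init i j q : (i < j)%N -> (q < nth 0 (val la) j)%N ->
  #|tail i q :|: init j q| = #|[set k : 'I_n | (k < nth 0 (val la) i)%N]|.+1.
Proof.
move=> ij qj; have le_ij := nth_intpart_le (ltnW ij).
have cardX : #|tail i q| = #|[set k : 'I_n | (q <= k < nth 0 (val la) i)%N]|.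
  have c_inj : {in tail i q &, injective c}.
    move=> x y; rewrite !inE => /andP[/eqP rx _] /andP[/eqP ry _].
    by apply: rc_inj; rewrite rx ry.
  rewrite -(card_in_imset c_inj); apply: eq_card => k; rewrite inE.
  apply/imsetP/andP => [[x + ->]|[qk ki]].
    by rewrite inE => /andP[/eqP <- ->]; rewrite col_lt.
  by have [x rx cx] := ex_entry ki; exists x; rewrite ?inE ?rx ?cx ?eqxx.
have cardY : #|init j q| = #|[set k : 'I_n | (k <= q)%N]|.
  have c_inj : {in init j q &, injective c}.
    move=> x y; rewrite !inE => /andP[/eqP rx _] /andP[/eqP ry _].
    by apply: rc_inj; rewrite rx ry.
  rewrite -(card_in_imset c_inj); apply: eq_card => k; rewrite inE.
  apply/imsetP/idP => [[x + ->]|kq]; first by rewrite inE => /andP[].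
  have [x rx cx] := ex_entry (leq_ltn_trans kq qj).
  by exists x; rewrite ?inE ?rx ?cx ?eqxx.
have -> : #|tail i q :|: init j q| = (#|tail i q| + #|init j q|)%N.
  rewrite -cardsUI; have -> : tail i q :&: init j q = set0; last by rewrite cards0 addn0.
  apply/setP => x; rewrite !inE; case: eqP => //= ->.
  by rewrite -val_eqE ltn_eqF ?andbF.
rewrite cardX cardY -cardsUI -addn1; have := leq_trans qj le_ij.
move: (nth 0 (val la) i) => l ql; congr (_ + _)%N.
  by apply: eq_card => k; rewrite !inE; apply/idP/idP; lia.
rewrite -(cards1 q); apply: eq_card => k; rewrite !inE -val_eqE /=.
by apply/idP/idP; lia.
Qed.

(** For [t] in the row stabilizer, the preimages of the set under [t] lie in rows no longer than row
    [i], while the set has one element more than that row. So two preimages share a column. Swapping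
    these negates [u], which amounts to [tperm x y] negating [msym t u], and the symmetrizer over
    the set absorbs [tperm x y]. *)
Lemma garnir i j q x0 w : (i < j)%N -> (q < nth 0 (val la) j)%N ->
  sym false (collapse (tail i q :|: init j q) x0) (sym false r (sym true c w)) = 0.
Proof.
move=> ij qj; set Z := _ :|: _; set u := sym true c w.
rewrite [sym false r u]/sym linear_sum big1 //= => t /stabP rt.
rewrite chi_false scale1r.
have : ~~ dinjectiveb (fun x => c (t^-1%g x)) (mem Z).
  apply/dinjectiveP => inj.
  have /subset_leq_card : [set c (t^-1%g x) | x in Z] \subset
      [set k : 'I_n | (k < nth 0 (val la) i)%N].
    apply/subsetP => _ /imsetP[x xZ ->]; rewrite inE.
    have rx : r (t^-1%g x) = r x by rewrite -{2}[x](permKV t) rt.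
    apply: leq_trans (col_lt _) _; rewrite rx; apply: nth_intpart_le.
    by move: xZ; rewrite !inE => /orP[] /andP[/eqP -> _] //; exact: ltnW.
  by rewrite card_in_imset ?card_tail_init ?ltnn.
move=> /dinjectivePn[x /= xZ [y /andP[/= yx yZ] cxy]].
apply: (@sym_eq0 _ _ _ (tperm x y)).
  by apply: stab_tperm; rewrite /collapse xZ [y \in Z]yZ.
rewrite chi_false scaleN1r -msymMm.
have -> : (t * tperm x y = tperm (t^-1 x) (t^-1 y) * t)%g.
  by rewrite -tpermJ conjgE invgK mulgA mulgKV.
rewrite msymMm /u sym_stabl ?stab_tperm // chi_tperm ?scaleN1r ?linearN //.
by rewrite (inj_eq perm_inj) eq_sym.
Qed.

(** Constant on row orbits; it orders the monomials both for straightening and for the triangularity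
    behind independence. *)
Definition row_weight m : nat := \sum_x r x * m x.

Lemma row_weight_stab m t : stab r t -> row_weight (m # t) = row_weight m.
Proof.
move=> /stabP rt; rewrite /row_weight [RHS](reindex_inj (@perm_inj _ t)).
by apply: eq_bigr => x _; rewrite mnmE rt.
Qed.

Lemma row_weight_le m : (row_weight m <= n * mdeg m)%N.
Proof.
rewrite mdegE big_distrr; apply: leq_sum => x _.
by rewrite leq_mul2r ltnW ?orbT.
Qed.

(** By rearrangement, a permutation maximizing the column-weighted sum of the exponents sorts every
    row. *)
Lemma row_sorted_perm m : exists2 t, stab r t &
  forall x y, r x = r y -> (c x < c y)%N -> (m (t x) <= m (t y))%N.
Proof.
case: (@arg_maxnP _ _ (stab r) (fun t => \sum_x c x * m (t x))%N (stab1 r)) => t rt tmax.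
exists t => // x y rxy cxy; rewrite leqNgt; apply/negP => myx.
have := tmax (tperm x y * t)%g; rewrite stabMr // stab_tperm // => /(_ isT).
apply/negP; rewrite -ltnNge; 
  have := sum_swap_lt (f := fun k => c k : nat) (g := fun k => m (t k)) cxy myx.
by congr (_ < _)%N; apply: eq_bigr => k _; rewrite permM.
Qed.

(** The exponents on the end of the upper row are at least [m x0], those on the start of the lower
    row at most [m y0]. So an exchange between the rows either carries a larger exponent downwards,
    raising the weight, or swaps equal exponents. *)
Lemma garnir_orbit z m (x0 y0 : 'I_n) :
    (forall t, stab r t -> msym t z = z) ->
    (forall x y, r x = r y -> (c x < c y)%N -> (m x <= m y)%N) ->
    (r x0 < r y0)%N -> c x0 = c y0 -> (m y0 <= m x0)%N ->
  forall t, stab (collapse (tail (r x0) (c x0) :|: init (r y0) (c x0)) x0) t ->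
    (row_weight m < row_weight (m # t))%N \/
    row_weight (m # t) = row_weight m /\ z@_(m # t) = z@_m.
Proof.
move=> zinv msort rxy cxy myx t.
set X := tail _ _; set Y := init _ _; set Z := X :|: Y.
have XY x : x \in X -> x \in Y -> False.
  rewrite !inE => /andP[/eqP -> _] /andP[/eqP rr _].
  by move: rxy; rewrite rr ltnn.
have mX x : x \in X -> (m x0 <= m x)%N.
  rewrite !inE => /andP[/eqP rx]; rewrite leq_eqVlt => /orP[/eqP/val_inj cx|].
    by rewrite (rc_inj rx (esym cx)).
  by apply: msort.
have mY x : x \in Y -> (m x <= m y0)%N.
  rewrite !inE cxy => /andP[/eqP rx]; rewrite leq_eqVlt => /orP[/eqP/val_inj cx|].
    by rewrite (rc_inj rx cx).
  by apply: msort.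
have x0Z : x0 \in Z by rewrite !inE eqxx leqnn.
(* Induction on the number of elements of [Y] that [t] sends into [X]. *)
move: {2}_.+1 (ltnSn #|[set y in Y | t y \in X]|) => k; elim: k t => // k IH t ltk tst.
have tZ x : (t x \in Z) = (x \in Z).
  have /stabP/(_ x) := tst; rewrite /collapse.
  case: ifP => tx; case: ifP => // xZ; first by move=> E; rewrite -E x0Z in xZ.
  by move=> E; rewrite E x0Z in tx.
have fixZ x : x \notin Z -> t x = x.
  move=> xZ; have /stabP/(_ x) := tst.
  by rewrite /collapse tZ (negPf xZ).
have [Y1_0|[y]] := set_0Vmem [set y in Y | t y \in X].
  (* Without crossings, [t] preserves [X] and [Y] separately, hence every row. *)
  right; suff rt : stab r t.
    by rewrite row_weight_stab // -mcoeff_sym zinv.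
  have tY x : x \in Y -> t x \in Y.
    move=> xY; have /setP/(_ x) := Y1_0; rewrite in_set0 inE xY /= => tX.
    by have := tZ x; rewrite !in_setU xY orbT tX.
  have imY : [set t x | x in Y] = Y.
    apply/eqP; rewrite eqEcard card_imset ?leqnn ?andbT; last exact: perm_inj.
    by apply/subsetP => _ /imsetP[x xY ->]; exact: tY.
  apply/stabP => x; have [xY|xY] := boolP (x \in Y).
    by have := tY x xY; move: xY; rewrite !inE => /andP[/eqP -> _] /andP[/eqP -> _].
  have [xX|xX] := boolP (x \in X); last by rewrite fixZ // in_setU negb_or xX.
  have : t x \in Z by rewrite tZ in_setU xX.
  rewrite in_setU => /orP[txX|]; last first.
    by rewrite -{1}imY mem_imset ?(negPf xY) //; exact: perm_inj.
  by move: xX txX; rewrite !inE => /andP[/eqP -> _] /andP[/eqP -> _].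
rewrite inE => /andP[yY tyX].
have [x xX txY] : exists2 x, x \in X & t x \in Y.
  apply/exists_inP; apply: contraT; rewrite negb_exists_in => /forall_inP noX.
  have tX x : x \in X -> t x \in X.
    move=> xX; have := noX x xX; have : t x \in Z by rewrite tZ in_setU xX.
    by rewrite in_setU => /orP[|->].
  have imX : [set t x | x in X] = X.
    apply/eqP; rewrite eqEcard card_imset ?leqnn ?andbT; last exact: perm_inj.
    by apply/subsetP => _ /imsetP[x xX ->]; exact: tX.
  move: tyX; rewrite -imX mem_imset; last exact: perm_inj.
  by move=> /XY/(_ yY).
(* One crossing undone: [x] and [y] exchange their images. *)
pose t' := (tperm x y * t)%g.
have xy : x != y by apply: contraPneq xX => ->; move/XY; exact.
have rxy' : (r x < r y)%N.
  by move: xX yY; rewrite !inE => /andP[/eqP-> _] /andP[/eqP-> _].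
have t'st : stab (collapse Z x0) t'.
  by rewrite stabMr // stab_tperm // /collapse !in_setU xX yY orbT.
have lt' : (#|[set y in Y | t' y \in X]| < k)%N.
  rewrite -ltnS; apply: leq_trans ltk; rewrite ltnS; apply: proper_card.
  apply/properP; split; last first.
    exists y; rewrite inE ?yY // permM tpermR.
    by apply/negP => /andP[_ /XY]; apply.
  apply/subsetP => l; rewrite 2!inE permM => /andP[lY].
  rewrite lY; case: tpermP => // [lx|-> ]; first by move: lY; rewrite lx => /(XY _ xX).
  by move/XY => /(_ txY).
have tE l : t l = t' (tperm x y l) by rewrite permM tpermK.
have le_val : (m (t x) <= m (t y))%N.
  by rewrite (leq_trans (mY _ txY)) // (leq_trans myx) // mX.
have := IH t' lt' t'st; case: (ltngtP (m (t x)) (m (t y))) le_val => // mt _.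
  have lt_w : (row_weight (m # t') < row_weight (m # t))%N.
    have -> : row_weight (m # t) = (\sum_l r l * m (t' (tperm x y l)))%N.
      by apply: eq_bigr => l _; rewrite mnmE tE.
    have -> : row_weight (m # t') = (\sum_l r l * m (t' l))%N.
      by apply: eq_bigr => l _; rewrite mnmE.
    apply: (sum_swap_lt (f := fun l => r l : nat) (g := fun l => m (t' l)) rxy').
    by rewrite !permM tpermL tpermR.
  by case=> [lt_m|[E _]]; left; [exact: ltn_trans lt_m lt_w | rewrite -E].
suff -> : m # t = m # t' by [].
apply/mnmP => l; rewrite !mnmE permM; case: tpermP => [->|->|] //.
Qed.

Definition ssyt_mnm (M : ssyt la) : 'X_{1..n} := [multinom val M (box_of T i) | i < n].

Lemma tab_monE M : tab_mon M T = 'X_[ssyt_mnm M].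
Proof. by rewrite mpolyXE_id; apply: eq_bigr => i _; rewrite mnmE. Qed.

(** Downward induction on the row weight, which is bounded in each degree. A row-sorted exponent
    that is not semistandard violates strictness in some column. In the Garnir relation for that
    place, coefficients of larger weight vanish by induction and the remaining ones all equal the
    one sought. *)
Lemma straightening w k :
    (msize w <= k)%N ->
    (forall M, (mdeg (ssyt_mnm M) < k)%N ->
       (sym false r (sym true c w))@_(ssyt_mnm M) = 0) ->
  sym false r (sym true c w) = 0.
Proof.
move=> wk; set z := sym false r _ => z0.
have zk : (msize z <= k)%N by rewrite !(leq_trans (msize_sym _ _ _)).
have zinv t : stab r t -> msym t z = z.
  by move=> rt; rewrite /z sym_stabl // chi_false scale1r.
apply/mpolyP => m; rewrite mcoeff0.
have [km|mk] := leqP k (mdeg m); first by rewrite mcoeff_msize // (leq_trans zk).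
move: {2}_.+1 (ltnSn (n * mdeg m - row_weight m)) => b.
elim: b m mk => // b IH m0 mk0 lt_b.
have [t rt] := row_sorted_perm m0; set m := m0 # t => tsort.
have mE : z@_m0 = z@_m by rewrite -mcoeff_sym zinv.
have mw : row_weight m0 = row_weight m by rewrite row_weight_stab.
have md : mdeg m0 = mdeg m by rewrite mdeg_mperm.
rewrite mE; rewrite mw md in lt_b mk0.
have msort x y : r x = r y -> (c x < c y)%N -> (m x <= m y)%N.
  by rewrite !mnmE; exact: tsort.
move: m {mE mw md tsort} msort lt_b mk0 => m msort lt_b mk.
pose M : {ffun box la -> nat} := [ffun b => m (val T b)].
have [Mssyt|] := boolP (is_ssyt M).
  pose M' : ssyt la := exist (fun M : {ffun box la -> nat} => is_true (is_ssyt M)) M Mssyt.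
  have ME : ssyt_mnm M' = m.
    by apply/mnmP => x; rewrite mnmE ffunE box_ofK.
  by rewrite -ME z0 ?ME.
move=> /forallPn[a /forallPn[d]]; rewrite negb_and !negb_imply => /orP[].
  move=> /andP[/andP[/eqP rr cc]]; rewrite !ffunE => /negP[]; apply: msort => //.
    by rewrite /rowf !numberingK.
  by rewrite /colf !numberingK.
move=> /andP[/andP[/eqP cc rr]]; rewrite !ffunE -leqNgt => mda.
set x0 := val T a in mda; set y0 := val T d in mda.
have rxy : (r x0 < r y0)%N by rewrite /rowf !numberingK.
have cxy : c x0 = c y0 by rewrite /colf !numberingK.
have orb := garnir_orbit zinv msort rxy cxy mda.
have cx0 : (c x0 < nth 0 (val la) (r y0))%N by rewrite cxy col_lt.
have /(congr1 (mcoeff m)) := garnir x0 w rxy cx0; rewrite -/z mcoeff0.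
set C := collapse _ _ in orb *; rewrite /sym raddf_sum /= => zsum.
apply/eqP; apply: contraTT isT => zm.
(* The number of terms equal to [z@_m]; the identity is among them, so it is positive. *)
pose N := #|[pred t | stab C t && (z@_(m # t) == z@_m)]|.
have : N%:R * z@_m = 0.
  rewrite -zsum mulr_natl -sumr_const big_mkcondr; apply: eq_bigr => s Cs.
  rewrite mcoeffZ chi_false mul1r mcoeff_sym; case: eqP => // ne.
  have [lt_w|[_ E]] := orb s Cs; last by rewrite E in ne.
  rewrite IH ?mdeg_mperm //.
  rewrite -ltnS; apply: leq_trans lt_b; rewrite ltnS.
  by apply: ltn_sub2l => //; apply: leq_trans lt_w _;
    rewrite -(mdeg_mperm m s) row_weight_le.
move/eqP; rewrite mulf_eq0 (negPf zm) orbF pnatr_eq0 => /eqP/card0_eq/(_ 1%g).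
by rewrite !inE stab1 mperm1 eqxx.
Qed.

End Straightening.

(** * Spanning *)

Section Spans.
Variables (K : fieldType) (V : lmodType K).
Implicit Types (S : V -> Prop) (u v : V).

Lemma lspan_gen S v : S v -> lspan S v.
Proof.
move=> Sv; exists [:: (1, v)]; split; last by rewrite big_seq1 scale1r.
by move=> x; rewrite inE => /eqP ->.
Qed.

Lemma lspan0 S : lspan S 0.
Proof. by exists [::]; split=> //; rewrite big_nil. Qed.

Lemma lspanD S u v : lspan S u -> lspan S v -> lspan S (u + v).
Proof.
move=> [s [Ss ->]] [t [St ->]]; exists (s ++ t); split; last by rewrite big_cat.
by move=> x; rewrite mem_cat => /orP[/Ss|/St].
Qed.

Lemma lspanZ S a v : lspan S v -> lspan S (a *: v).
Proof.
move=> [s [Ss ->]]; exists [seq (a * x.1, x.2) | x <- s]; split.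
  by move=> _ /mapP[x /Ss Sx ->].
by rewrite big_map scaler_sumr; apply: eq_bigr => x _; rewrite scalerA.
Qed.

Lemma lspan_sum S (I : eqType) (s : seq I) (F : I -> V) :
  (forall i, i \in s -> lspan S (F i)) -> lspan S (\sum_(i <- s) F i).
Proof.
elim: s => [|i s IH] SF; first by rewrite big_nil; exact: lspan0.
rewrite big_cons; apply: lspanD; first by apply: SF; rewrite mem_head.
by apply: IH => j js; apply: SF; rewrite inE js orbT.
Qed.

Lemma lspan_ind S (W : V -> Prop) :
    W 0 -> (forall u v, W u -> W v -> W (u + v)) ->
    (forall a v, W v -> W (a *: v)) -> (forall v, S v -> W v) ->
  forall v, lspan S v -> W v.
Proof.
move=> W0 WD WZ SW v [s [+ ->]]; elim: s => [|x s IH] Ss; first by rewrite big_nil.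
rewrite big_cons; apply: WD; first by apply/WZ/SW/Ss; rewrite mem_head.
by apply: IH => y ys; apply: Ss; rewrite inE ys orbT.
Qed.

Variables (I : eqType) (P : pred I) (S : I -> V -> Prop).

Lemma lspan_subspace_sum v :
  lspan (fun u => exists i, P i /\ S i u) v -> subspace_sum P (fun i => lspan (S i)) v.
Proof.
apply: lspan_ind => [|u w|a w [s [F [us Ps SF ->]]]|u [i [Pi Su]]].
- by exists [::], (fun=> 0); split => //; rewrite big_nil.
- move=> [s [F [us Ps SF ->]]] [t [G [ut Pt SG ->]]].
  (* Extension by zero, so that two families can be added over a common list of indices. *)
  pose H (x : seq I * (I -> V)) i : V := if i \in x.1 then x.2 i else 0 : V.
  have HE (x : seq I * (I -> V)) (l : seq I) : {subset x.1 <= l} -> uniq x.1 -> uniq l ->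
      \sum_(i <- l) H x i = \sum_(i <- x.1) x.2 i.
    move=> sub ux ul; rewrite /H -big_mkcond -big_filter; apply: perm_big.
    apply: uniq_perm => [|//|i]; first exact: filter_uniq.
    by rewrite mem_filter andb_idr // => /sub.
  exists (undup (s ++ t)), (fun i => H (s, F) i + H (t, G) i); split.
  + exact: undup_uniq.
  + apply/allP => i; rewrite mem_undup mem_cat => /orP[].
      by move/(allP Ps).
    by move/(allP Pt).
  + move=> i _; apply: lspanD; rewrite /H /=; case: ifP => ? //; try exact: lspan0.
      exact: SF.
    exact: SG.
  rewrite big_split /= !HE ?undup_uniq // => i /= si;
    by rewrite mem_undup mem_cat si ?orbT.
- exists s, (fun i => a *: F i); split; rewrite ?scaler_sumr // => i si.
  exact/lspanZ/SF.
exists [:: i], (fun=> u); split; rewrite ?big_seq1 ?andbT //=.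
  by rewrite Pi.
by move=> j; rewrite inE => /eqP ->; exact: lspan_gen.
Qed.

End Spans.

(** [S] is an arbitrary predicate, so excluded middle decides whether some vector lies outside the
    row space; adjoining it raises the rank, which bounds the number of rounds. *)
Lemma spanning_matrix (K : fieldType) N (S : 'rV[K]_N -> Prop) :
  exists m (A : 'M[K]_(m, N)),
    (forall i, lspan S (row i A)) /\ forall v, S v -> (v <= A)%MS.
Proof.
suff ext d m (A : 'M[K]_(m, N)) : (N - \rank A <= d)%N ->
    (forall i, lspan S (row i A)) -> exists m (A : 'M[K]_(m, N)),
    (forall i, lspan S (row i A)) /\ forall v, S v -> (v <= A)%MS.
  by apply: (ext N 0 (0 : 'M_(0, N))); [rewrite leq_subr | case].
elim: d m A => [|d IH] m A rA SA.
  exists m, A; split=> // v _; apply: submx_full.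
  by rewrite /row_full eqn_leq rank_leq_col -subn_eq0 -leqn0.
have [SvA|/not_all_ex_not[v /(imply_to_and (S v))[Sv vA]]] :=
  classic (forall v, S v -> (v <= A)%MS); first by exists m, A.
apply: (IH _ (col_mx A v)) => [|i]; last first.
  rewrite -(splitK i); case: (split i) => j /=; rewrite ?rowKu ?rowKd //.
  by rewrite row_id; exact: lspan_gen.
suff : (\rank A < \rank (col_mx A v))%N by lia.
have : (A < col_mx A v)%MS; last by rewrite ltmxErank => /andP[].
rewrite /ltmx -!addsmxE addsmxSl /= addsmx_sub submx_refl /=.
exact/negP.
Qed.

(** * Orthogonal duality in bounded degree *)

Section Duality.
Variables (n k : nat).
Implicit Types p f w : {mpoly rat[n]}.
Let N := #|{: 'X_{1..n < k}}|.

Let mon (j : 'I_N) : 'X_{1..n < k} := enum_val j.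
Let vec p : 'rV[rat]_N := \row_j p@_(mon j).
Let unvec (v : 'rV[rat]_N) : {mpoly rat[n]} := \sum_j v 0 j *: 'X_[mon j].

Let coef_unvec v j : (unvec v)@_(mon j) = v 0 j.
Proof.
rewrite /unvec raddf_sum (bigD1 j) //= mcoeffZ mcoeffX eqxx mulr1.
rewrite big1 ?addr0 // => i ij; rewrite mcoeffZ mcoeffX.
by rewrite -bmeqP (inj_eq enum_val_inj) (negPf ij) mulr0.
Qed.

Let msize_unvec v : (msize (unvec v) <= k)%N.
Proof.
apply: msize_leP => m km; rewrite /unvec raddf_sum big1 // => j _ /=.
rewrite mcoeffZ mcoeffX; case: eqP => [E|]; last by rewrite mulr0.
by move: km; rewrite -E leqNgt bmdeg.
Qed.

Let vecK p : (msize p <= k)%N -> unvec (vec p) = p.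
Proof.
move=> pk; apply/mpolyP => m; have [mk|km] := ltnP (mdeg m) k.
  have -> : m = mon (enum_rank (BMultinom mk)) by rewrite /mon enum_rankK.
  by rewrite coef_unvec mxE.
by rewrite !mcoeff_msize // (leq_trans _ km).
Qed.

Lemma lspan_dual (S : {mpoly rat[n]} -> Prop) p :
    (msize p <= k)%N -> (forall f, S f -> (msize f <= k)%N) ->
    (forall w, (msize w <= k)%N -> (forall f, S f -> ip k f w = 0) -> ip k p w = 0) ->
  lspan S p.
Proof.
move=> pk Sk dual.
have [m [A [rA SA]]] := spanning_matrix (fun v => exists2 f, S f & v = vec f).
have vspan v : lspan (fun v => exists2 f, S f & v = vec f) v -> lspan S (unvec v).
  move: v; apply: lspan_ind => [|u v Su Sv|a v Sv|_ [f Sf ->]].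
  - by rewrite /unvec big1 => [|j _]; rewrite ?mxE ?scale0r //; exact: lspan0.
  - have -> : unvec (u + v) = unvec u + unvec v; last exact: lspanD.
    by rewrite -big_split; apply: eq_bigr => j _; rewrite mxE scalerDl.
  - have -> : unvec (a *: v) = a *: unvec v; last exact: lspanZ.
    by rewrite scaler_sumr; apply: eq_bigr => j _; rewrite mxE scalerA.
  by rewrite vecK ?Sk //; exact: lspan_gen.
have [/submxP[D pD]|] := boolP (vec p <= A)%MS.
  rewrite -(vecK pk); apply: vspan; rewrite pD mulmx_sum_row.
  by apply: lspan_sum => i _; exact: lspanZ.
rewrite submxE => /eqP pA; case: pA; apply/rowP => j; rewrite [RHS]mxE.
(* The columns of the cokernel of [A] are orthogonal to its rows and detect every vector outside
   their span. *)
pose w := unvec (col j (cokermx A))^T.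
have ipw f : ip k f w = (vec f *m cokermx A) 0 j.
  rewrite mxE /ip (reindex_onto mon enum_rank) /=; last first.
    by move=> i _; rewrite /mon enum_rankK.
  apply: eq_big => [i|i _]; first by rewrite /mon enum_valK eqxx.
  by rewrite coef_unvec !mxE.
rewrite -ipw; apply: dual => [|f Sf]; first exact: msize_unvec.
rewrite ipw; have /eqP : vec f *m cokermx A == 0 by rewrite -submxE SA //; exists f.
by move=> ->; rewrite mxE.
Qed.

End Duality.

Lemma row_fix_neq0 n (la : intpart n) (M : ssyt la) (T : numbering la) :
  (row_fix M T)%:R != 0 :> rat.
Proof.
rewrite pnatr_eq0 -lt0n; apply/card_gt0P; exists 1%g.
by rewrite inE row_stabE stab1 msym1m eqxx.
Qed.

Lemma specht_polyE n (la : intpart n) (M : ssyt la) (T : numbering la) :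
  specht_poly M T = (row_fix M T)%:R^-1 *:
    sym true (colf T) (sym false (rowf T) 'X_[ssyt_mnm T M]).
Proof. by rewrite /specht_poly young_symmE tab_monE. Qed.

(** By duality, a [w] orthogonal to all generators of degree less than [k] has to vanish.
    Self-adjointness turns this orthogonality into the zero coefficients that [straightening] asks
    for, which contradicts [young_dual_nonzero] unless [w = 0]. *)
Lemma specht_poly_span n (p : {mpoly rat[n]}) :
  lspan (fun f => exists x : ssyt_index n, true /\
           exists T : numbering (tag x), f = specht_poly (tagged x) T) p.
Proof.
pose k := msize p.
pose S (f : {mpoly rat[n]}) := exists (la : intpart n) (M : ssyt la) (T : numbering la),
  (mdeg (ssyt_mnm T M) < k)%N /\
  f = sym true (colf T) (sym false (rowf T) 'X_[ssyt_mnm T M]).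
suff : lspan S p.
  apply: lspan_ind => [||a v|f [la [M [T [_ ->]]]]]; [exact: lspan0|exact: lspanD|exact: lspanZ|].
  have -> : sym true (colf T) (sym false (rowf T) 'X_[ssyt_mnm T M]) =
      (row_fix M T)%:R *: specht_poly M T.
    by rewrite specht_polyE scalerA divff ?scale1r ?row_fix_neq0.
  by apply/lspanZ/lspan_gen; exists (Tagged _ M); split=> //; exists T.
apply: (@lspan_dual _ k) => [//|f [la [M [T [Mk ->]]]]|w wk wS].
  by rewrite !(leq_trans (msize_sym _ _ _)) // msizeX.
suff -> : w = 0 by rewrite linear0.
apply: NNPP => /eqP/young_dual_nonzero[la [T /eqP[]]].
apply: (straightening wk) => M Mk.
by rewrite -(ipX _ Mk) -!ip_sym wS //; exists la, M, T.
Qed.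

(** * Independence *)

Section Independence.
Variables (n : nat) (la : intpart n) (T : numbering la).
Local Notation r := (rowf T).
Local Notation c := (colf T).
Implicit Types (m : 'X_{1..n}) (s t : 'S_n) (p q : {mpoly rat[n]}) (M : ssyt la).
Local Notation "m # s" := [multinom (m : 'X_{1..n}) (s i) | i < n]
  (at level 40, left associativity).
Local Notation sp p := (sym true c (sym false r p)).

Lemma ex_above x (i : 'I_n) : (i <= r x)%N -> exists2 y, r y = i & c y = c x.
Proof. by move=> ix; apply: ex_entry; rewrite (leq_trans (col_lt _ _)) ?nth_intpart_le. Qed.

Lemma ssyt_row M x y : r x = r y -> (c x < c y)%N ->
  (ssyt_mnm T M x <= ssyt_mnm T M y)%N.
Proof.
move=> rr cc; rewrite !mnmE; have /forallP/(_ (box_of T x)) := valP M.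
move=> /forallP/(_ (box_of T y))/andP[/implyP + _]; apply.
by rewrite -/(rowf T x) -/(rowf T y) rr eqxx.
Qed.

Lemma ssyt_col M x y : c x = c y -> (r x < r y)%N ->
  (ssyt_mnm T M x < ssyt_mnm T M y)%N.
Proof.
move=> cc rr; rewrite !mnmE; have /forallP/(_ (box_of T x)) := valP M.
move=> /forallP/(_ (box_of T y))/andP[_ /implyP]; apply.
by rewrite -/(colf T x) -/(colf T y) cc eqxx.
Qed.

(** Columns of [M] strictly increase, so a maximizer preserves the row order inside each column, or
    else a swap would gain. Then no entry moves up, and equal sums of rows force [s] to be the
    identity. *)
Lemma max_row_weight M s : stab c s ->
    (forall t, stab c t ->
       row_weight T (ssyt_mnm T M # t) <= row_weight T (ssyt_mnm T M # s))%N ->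
  s = 1%g.
Proof.
move=> cs smax; set m := ssyt_mnm T M in smax.
have mono x y : c x = c y -> (r x < r y)%N -> (r (s x) < r (s y))%N.
  move=> cxy rxy; have cxy' : c (s x) = c (s y) by rewrite !(stabP _ _ cs).
  rewrite ltnNge leq_eqVlt; apply/negP => /orP[/eqP/val_inj rr|rr].
    by move: rxy; rewrite (perm_inj (rc_inj rr (esym cxy'))) ltnn.
  have lt_m := ssyt_col M (esym cxy') rr.
  have := smax (tperm x y * s)%g; rewrite stabMr // stab_tperm // => /(_ isT).
  apply/negP; rewrite -ltnNge.
  have := sum_swap_lt (f := fun k => r k : nat) (g := fun k => m (s k)) rxy lt_m.
  by congr (_ < _)%N; apply: eq_bigr => k _; rewrite mnmE ?permM.
have le_r x : (r x <= r (s x))%N.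
  move rx: (nat_of_ord (r x)) => k; elim: k x rx => [|k IH] x rx //.
  have kn : (k < n)%N by have := ltn_ord (r x); rewrite rx; exact: ltnW.
  have [|y ry cy] := @ex_above x (Ordinal kn); first by rewrite rx.
  have ryx : (r y < r x)%N by rewrite ry rx.
  apply: leq_ltn_trans (mono _ _ cy ryx).
  by apply: IH; rewrite ry.
have sumE : (\sum_x r (s x) <= \sum_x r x)%N.
  by rewrite [leqRHS](reindex_inj (@perm_inj _ s)).
apply/permP => x; rewrite perm1; apply: (@rc_inj _ _ T); last by rewrite (stabP _ _ cs).
by apply/val_inj/esym; exact: (eq_of_leq_sum (fun x _ => le_r x) sumE).
Qed.

Lemma row_weight_lt M s : stab c s -> s != 1%g ->
  (row_weight T (ssyt_mnm T M # s) < row_weight T (ssyt_mnm T M))%N.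
Proof.
move=> cs; apply: contraR; rewrite -leqNgt => le_s; apply/eqP.
case: (@arg_maxnP _ _ (stab c) (fun t => row_weight T (ssyt_mnm T M # t)) (stab1 c)).
move=> t ct tmax; have t1 : t = 1%g by apply: (max_row_weight ct) => u; exact: tmax.
apply: (max_row_weight cs) => u cu; apply: leq_trans (tmax u cu) _.
by rewrite t1 mperm1.
Qed.

(** A sorted row is determined by its multiset of entries: if [m x < m' x], more entries of that row
    lie below [m' x] in [m] than in [m'], although [t] matches them. *)
Lemma ssyt_row_eq M M' t : stab r t ->
  ssyt_mnm T M' = ssyt_mnm T M # t -> ssyt_mnm T M' = ssyt_mnm T M.
Proof.
move=> rt; set m := ssyt_mnm T M; set m' := ssyt_mnm T M' => mm'.
have m'E x : m' x = m (t x) by rewrite mm' mnmE.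
have le_m x : (m' x <= m x)%N.
  rewrite leqNgt; apply/negP => lt_m.
  pose A := [set y | (r y == r x) && (m y < m' x)%N].
  pose B := [set y | (r y == r x) && (m' y < m' x)%N].
  have BA : (#|B| < #|A|)%N.
    apply/proper_card/properP; split; last first.
      by exists x; rewrite !inE eqxx // ltnn.
    apply/subsetP => y; rewrite !inE => /andP[/eqP ry ym]; rewrite ry eqxx /=.
    apply: leq_ltn_trans lt_m.
    have [cyx|cxy|/val_inj cyx] := ltngtP (c y) (c x).
    - exact: ssyt_row.
    - by move: ym; rewrite ltnNge (@ssyt_row M' x y).
    - by rewrite (rc_inj ry cyx).
  move: BA; rewrite -(card_imset (mem B) (@perm_inj _ t)) ltnNge subset_leq_card //.
  apply/subsetP => y yA; apply/imsetP; exists (t^-1%g y); rewrite ?permKV //.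
  have m't : m' (t^-1%g y) = m y by rewrite m'E permKV.
  move: yA; rewrite !inE m't => /andP[/eqP <- ->].
  by rewrite -[r (_ y)](stabP _ _ rt) permKV eqxx.
have sumE : (\sum_x m x <= \sum_x m' x)%N.
  rewrite [leqLHS](reindex_inj (@perm_inj _ t)).
  by apply: leq_sum => x _; rewrite m'E.
by apply/mnmP => x; exact: (eq_of_leq_sum (fun x _ => le_m x) sumE).
Qed.

Lemma ssyt_mnm_inj : injective (ssyt_mnm T).
Proof.
move=> M M' /mnmP MM; apply/val_inj/ffunP => b.
by have := MM (val T b); rewrite !mnmE numberingK.
Qed.

(** Triangularity for the row weight, read off at the monomial of [M]. Tableaux of smaller weight
    have zero coefficients by induction; any other [M'] contributes only if s = 1, by
    [row_weight_lt], and then [M' = M]. *)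
Lemma specht_free (l : seq (ssyt la)) (y : ssyt la -> rat) : uniq l ->
    \sum_(M <- l) y M *: sp 'X_[ssyt_mnm T M] = 0 ->
  forall M, M \in l -> y M = 0.
Proof.
move=> ul sum0 M; move: {2}_.+1 (ltnSn (row_weight T (ssyt_mnm T M))) => b.
elim: b M => // b IH M; rewrite ltnS => leb Ml.
have coefE M' : (sp 'X_[ssyt_mnm T M'])@_(ssyt_mnm T M) =
    \sum_(s | stab c s) \sum_(t | stab r t)
      chi true s * (ssyt_mnm T M' == ssyt_mnm T M # s # t)%:R.
  rewrite [sym true _ _]/sym raddf_sum; apply: eq_bigr => s _ /=.
  rewrite mcoeffZ mcoeff_sym /sym raddf_sum mulr_sumr; apply: eq_bigr => t _ /=.
  by rewrite mcoeffZ chi_false mul1r mcoeff_sym mcoeffX.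
pose N := #|[pred t | stab r t && (ssyt_mnm T M == ssyt_mnm T M # t)]|.
have yN : y M * N%:R = 0.
  move: sum0 => /(congr1 (mcoeff (ssyt_mnm T M))); rewrite raddf_sum mcoeff0 /= => <-.
  under [RHS]eq_bigr do rewrite mcoeffZ coefE.
  rewrite [RHS](bigD1_seq M Ml ul).
  rewrite [X in _ = _ * X + _](bigD1 1%g (stab1 c)) mperm1 chi1.
  rewrite [X in _ = _ * (_ + X) + _]big1 ?addr0; last first.
    move=> s /andP[cs s1]; rewrite big1 // => t rt; case: eqP => [E|]; rewrite ?mulr0 //.
    have := row_weight_lt M cs s1.
    by rewrite -(row_weight_stab _ rt) -E ltnn.
  rewrite [X in _ = _ + X]big_seq_cond [X in _ = _ + X]big1 ?addr0.
    congr (_ * _); rewrite /N -sum1_card natr_sum big_mkcondr; apply: eq_bigr => t _.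
    by rewrite mul1r; case: eqP.
  move=> M' /andP[M'l M'M].
  have [s0|lt_w] := leqP (row_weight T (ssyt_mnm T M)) (row_weight T (ssyt_mnm T M')); last first.
    by rewrite IH ?mul0r // (leq_trans lt_w).
  rewrite big1 ?mulr0 // => s cs; rewrite big1 // => t rt.
  case: eqP => [E|]; rewrite ?mulr0 //; have [s1|s1] := eqVneq s 1%g.
    move: E; rewrite s1 mperm1 => /(ssyt_row_eq rt)/ssyt_mnm_inj E.
    by rewrite E eqxx in M'M.
  by move: s0; rewrite E row_weight_stab // leqNgt row_weight_lt.
move/eqP: yN; rewrite mulf_eq0 => /orP[/eqP //|].
rewrite pnatr_eq0 => /eqP/card0_eq/(_ 1%g).
by rewrite !inE stab1 mperm1 eqxx.
Qed.

(** * Comparing the rows of T with another row function *)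

Section Columns.
Variable r' : 'I_n -> 'I_n.
Hypothesis cr_inj : forall x y, c x = c y -> r' x = r' y -> x = y.

(** A column of the diagram reaching row [k] fills all rows above it, which is the most that the
    injective [r'] allows; a shorter column is counted in full. *)
Lemma card_col_lt j k :
  (#|[set x | (c x == j) && (r' x < k)%N]| <= #|[set x | (c x == j) && (r x < k)%N]|)%N.
Proof.
have [/existsP[x0 /andP[/eqP cx0 kx0]]|] := boolP [exists x, (c x == j) && (k <= r x)%N].
  apply: (@leq_trans #|[set i : 'I_n | (i < k)%N]|).
    rewrite -(card_in_imset (f := r')); last first.
      move=> x y; rewrite !inE => /andP[/eqP cx _] /andP[/eqP cy _].
      by apply: cr_inj; rewrite cx cy.
    apply/subset_leq_card/subsetP => _ /imsetP[x + ->].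
    by rewrite !inE => /andP[].
  apply: leq_trans (leq_imset_card r _).
  apply/subset_leq_card/subsetP => i; rewrite inE => ik.
  have [|x rx cx] := @ex_above x0 i; first by rewrite (leq_trans (ltnW ik)).
  by apply/imsetP; exists x; rewrite // inE cx cx0 eqxx rx.
move=> /existsPn small; apply/subset_leq_card/subsetP => x; rewrite !inE.
move=> /andP[cx _]; rewrite cx /=; have := small x.
by rewrite cx /= -ltnNge.
Qed.

Lemma card_col_sum (f : 'I_n -> 'I_n) k :
  (\sum_j #|[set x | (c x == j) && (f x < k)%N]| = #|[set x | (f x < k)%N]|)%N.
Proof.
rewrite -[RHS]sum1_card [RHS](partition_big c predT) //=; apply: eq_bigr => j _.
by rewrite -sum1_card; apply: eq_bigl => x; rewrite !inE andbC.
Qed.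

Lemma card_row_lt k : (#|[set x | (r' x < k)%N]| <= #|[set x | (r x < k)%N]|)%N.
Proof. by rewrite -!card_col_sum; apply: leq_sum => j _; exact: card_col_lt. Qed.

(** As [r'] rearranges [r], the totals over all columns agree, so [card_col_lt] is an equality in
    each column, and the [r']-values of a column are its rows. *)
Lemma column_perm (t : 'S_n) : (forall x, r' x = r (t x)) ->
  exists2 s : 'S_n, stab c s & forall x, r (s x) = r' x.
Proof.
move=> r'E.
have colE k j : #|[set x | (c x == j) && (r' x < k)%N]| =
                #|[set x | (c x == j) && (r x < k)%N]|.
  have sum_le : (\sum_j #|[set x | (c x == j) && (r x < k)%N]| <=
                 \sum_j #|[set x | (c x == j) && (r' x < k)%N]|)%N.
    rewrite !card_col_sum -(card_preimset _ (@perm_inj _ t)).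
    by apply/eq_leq/eq_card => x; rewrite !inE r'E.
  exact: (eq_of_leq_sum (fun j _ => card_col_lt j k) sum_le).
(* Otherwise passing from [r' x] to its successor adds nothing to the column count for [r], whereas
   [x] adds one for [r']. *)
have exs x : exists y, (c y == c x) && (r y == r' x).
  apply/existsP; apply: contraT => /existsPn no.
  suff : (#|[set y | (c y == c x) && (r' y < r' x)%N]| <
          #|[set y | (c y == c x) && (r' y < (r' x).+1)%N]|)%N.
    rewrite !colE ltnNge subset_leq_card //; apply/subsetP => y; rewrite !inE.
    move=> /andP[cy]; rewrite cy ltnS leq_eqVlt => /orP[ry|-> //].
    by have := no y; rewrite cy -val_eqE ry.
  apply/proper_card/properP; split.
    by apply/subsetP => y; rewrite !inE => /andP[-> /= ry]; rewrite ltnS ltnW.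
  by exists x; rewrite !inE eqxx ?ltnSn ?ltnn.
pose f x := xchoose (exs x).
have fP x : c (f x) = c x /\ r (f x) = r' x.
  by have /andP[/eqP-> /eqP->] := xchooseP (exs x).
have f_inj : injective f.
  move=> x y fxy; have [cx rx] := fP x; have [cy ry] := fP y.
  by apply: cr_inj; [rewrite -cx -cy fxy | rewrite -rx -ry fxy].
exists (perm f_inj) => [|x]; last by rewrite permE; have [] := fP x.
by apply/stabP => x; rewrite permE; have [] := fP x.
Qed.

End Columns.

(** If two elements share a column of [T] and their preimages under [t] share a row, their
    transposition gives opposite signs and the scalar is 0. Otherwise [column_perm] yields a column
    permutation [s] such that t followed by [s] preserves rows, and the scalar is the sign of
    [s]. *)
Lemma von_neumann t p : exists a, sym true c (msym t (sym false r p)) = a *: sp p.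
Proof.
have [/existsP[x /existsP[y /and3P[xy /eqP cc /eqP rr]]]|no] := boolP
  [exists x, exists y, [&& x != y, c x == c y & r (t^-1%g x) == r (t^-1%g y)]].
  exists 0; rewrite scale0r; apply: (sym_eq0 (stab_tperm cc)).
  rewrite -msymMm chi_tperm // expr1 opprK scale1r.
  have -> : (t * tperm x y = tperm (t^-1 x) (t^-1 y) * t)%g.
    by rewrite -tpermJ conjgE invgK mulgA mulgKV.
  by rewrite msymMm sym_stabl ?stab_tperm // chi_false scale1r.
have inj x y : c x = c y -> r (t^-1%g x) = r (t^-1%g y) -> x = y.
  move=> cc rr; apply/eqP; apply: contraNT no => xy.
  by apply/existsP; exists x; apply/existsP; exists y; rewrite xy cc rr !eqxx.
have [s cs rs] := column_perm (r' := fun x => r (t^-1%g x)) inj (t := t^-1%g) (fun=> erefl).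
exists (chi true s).
have -> : msym t (sym false r p) = msym s^-1%g (sym false r p).
  apply: (inj_msym s); rewrite -!msymMm mulVg msym1m sym_stabl ?chi_false ?scale1r //.
  by apply/stabP => x; rewrite permM rs permK.
by rewrite sym_stabr ?stabV // chiV.
Qed.

End Independence.

(** * Directness *)

Section SameShape.
Variables (n : nat) (la : intpart n).
Implicit Types (T : numbering la) (M : ssyt la) (p q v : {mpoly rat[n]}).
Local Notation sp T p := (sym true (colf T) (sym false (rowf T) p)).

Lemma numbering_perm T T' : exists h : 'S_n, forall x, box_of T' x = box_of T (h x).
Proof.
have f_inj : injective (fun x => val T (box_of T' x)).
  by apply: inj_comp; [exact: can_inj (numberingK T) | exact: can_inj (box_ofK T')].
by exists (perm f_inj) => x; rewrite permE numberingK.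
Qed.

Lemma specht_conj T T' : exists h : 'S_n, forall M,
  sp T' 'X_[ssyt_mnm T' M] = msym h (sp T 'X_[ssyt_mnm T M]).
Proof.
have [h hE] := numbering_perm T T'; exists h^-1%g => M.
have -> : 'X_[ssyt_mnm T' M] = msym h^-1%g 'X_[ssyt_mnm T M] :> {mpoly rat[n]}.
  by rewrite msymX invgK; congr 'X_[_]; apply/mnmP => x; rewrite !mnmE hE.
have rE s : stab (rowf T') s = stab (rowf T \o h) s.
  by apply: eq_forallb => x; rewrite /rowf /= !hE.
have cE s : stab (colf T') s = stab (colf T \o h) s.
  by apply: eq_forallb => x; rewrite /colf /= !hE.
rewrite (eq_stab_sym _ _ cE) (eq_stab_sym _ _ rE).
apply: (inj_msym h); rewrite !symJ -[RHS]msymMm mulVg msym1m; congr (sym _ _ (sym _ _ _)).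
by rewrite -msymMm mulVg msym1m.
Qed.

(** The generator for [T'] is a translate of the one for [T]; expanding its column symmetrizer
    leaves terms to which [von_neumann] applies. *)
Lemma col_sym_specht T T' M :
  exists y, sym true (colf T) (specht_poly M T') = y *: sp T 'X_[ssyt_mnm T M].
Proof.
have [h hE] := specht_conj T T'.
have [y yE] : exists y, sym true (colf T) (msym h (sp T 'X_[ssyt_mnm T M])) =
    y *: sp T 'X_[ssyt_mnm T M].
  rewrite [X in msym h X]/sym (linear_sum (msym h)) (linear_sum (sym true (colf T))).
  apply: (big_ind (fun u => exists y, u = y *: sp T 'X_[ssyt_mnm T M])).
  - by exists 0; rewrite scale0r.
  - by move=> _ _ [a ->] [b ->]; exists (a + b); rewrite scalerDl.
  move=> s _; rewrite !linearZ /= -msymMm.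
  have [a ->] := von_neumann T (s * h)%g 'X_[ssyt_mnm T M].
  by exists (chi true s * a); rewrite scalerA.
by exists ((row_fix M T')%:R^-1 * y); rewrite specht_polyE hE linearZ /= yE scalerA.
Qed.

Lemma col_sym_space T M v : specht_space M v ->
  exists y, sym true (colf T) v = y *: sp T 'X_[ssyt_mnm T M].
Proof.
move: v; apply: lspan_ind => [|u v [a uE] [b vE]|a v [b vE]|v [T' ->]].
- by exists 0; rewrite linear0 scale0r.
- by exists (a + b); rewrite linearD /= uE vE scalerDl.
- by exists (a * b); rewrite linearZ /= vE scalerA.
exact: col_sym_specht.
Qed.

(** Moving column symmetrizers across the inner product shows [v] orthogonal to all generators of
    its own space, hence to itself. *)
Lemma specht_space_eq0 M v : specht_space M v ->
  (forall T, sym true (colf T) v = 0) -> v = 0.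
Proof.
move=> Mv cv; apply: (@ip_eq0 _ (msize v)) => //.
suff : forall u, specht_space M u -> ip (msize v) v u = 0 by apply.
apply: lspan_ind => [|u w uE wE|a u uE|_ [T ->]].
- exact: linear0.
- by rewrite linearD /= uE wE addr0.
- by rewrite linearZ /= uE mulr0.
by rewrite specht_polyE linearZ /= -ip_sym cv ipC linear0 mulr0.
Qed.

Lemma fin_choice (I : eqType) (A : Type) (a0 : A) (R : I -> A -> Prop) (s : seq I) :
  (forall i, i \in s -> exists a, R i a) -> exists f, forall i, i \in s -> R i (f i).
Proof.
elim: s => [|i s IH] H; first by exists (fun=> a0).
have [|f fR] := IH; first by move=> j js; apply: H; rewrite inE js orbT.
have [|a aR] := H i; first exact: mem_head.
exists (fun j => if j == i then a else f j) => j; rewrite inE.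
by case: eqVneq => [-> _|_] //=; exact: fR.
Qed.

Lemma direct_same_shape (l : seq (ssyt la)) (w : ssyt la -> {mpoly rat[n]}) :
    uniq l -> (forall M, M \in l -> specht_space M (w M)) ->
    \sum_(M <- l) w M = 0 -> forall M, M \in l -> w M = 0.
Proof.
move=> ul wl sum0 M Ml; apply: (specht_space_eq0 (wl M Ml)) => T.
have [y yE] := fin_choice 0 (fun M Ml => col_sym_space T (wl M Ml)).
rewrite yE // (@specht_free _ _ T l y ul _ M Ml) ?scale0r //.
transitivity (sym true (colf T) (\sum_(M <- l) w M)); last by rewrite sum0 linear0.
rewrite (linear_sum (sym true (colf T))) big_seq [RHS]big_seq.
by apply: eq_bigr => M' /yE <-.
Qed.

End SameShape.

(** * Orthogonality between different shapes *)

Section Shapes.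
Variables (n : nat).
Implicit Types (la : intpart n) (p q v : {mpoly rat[n]}).

Lemma card_row la (T : numbering la) (i : 'I_n) :
  #|[set x | rowf T x == i]| = nth 0 (val la) i.
Proof.
have c_inj : {in [set x | rowf T x == i] &, injective (colf T)}.
  by move=> x y; rewrite !inE => /eqP rx /eqP ry; apply: rc_inj; rewrite rx ry.
have le_n : (nth 0 (val la) i <= n)%N.
  by rewrite -[leqRHS](intpart_sumn la) nth_leq_sumn.
rewrite -(card_in_imset c_inj).
transitivity (\sum_(k < n | k < nth 0 (val la) i) 1)%N; last first.
  by rewrite (big_ord_narrow le_n) sum1_card card_ord.
rewrite sum1dep_card; apply: eq_card => k; rewrite inE; apply/imsetP/idP.
  by move=> [x]; rewrite inE => /eqP <- ->; exact: col_lt.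
by move=> ki; have [x rx cx] := ex_entry T ki; exists x; rewrite ?inE ?rx ?cx.
Qed.

Lemma shape_eq la la' (T : numbering la) (T' : numbering la') :
    (forall k, #|[set x | (rowf T' x < k)%N]| <= #|[set x | (rowf T x < k)%N]|)%N ->
    (forall k, #|[set x | (rowf T x < k)%N]| <= #|[set x | (rowf T' x < k)%N]|)%N ->
  la = la'.
Proof.
move=> le1 le2.
have ltE k : #|[set x | (rowf T x < k)%N]| = #|[set x | (rowf T' x < k)%N]|.
  by apply/eqP; rewrite eqn_leq le1 le2.
have rowE (l : intpart n) (S : numbering l) (i : 'I_n) : (#|[set x | (rowf S x < i)%N]| +
    nth 0 (val l) i = #|[set x | (rowf S x < i.+1)%N]|)%N.
  rewrite -(card_row S) -cardsUI [X in (_ + X)%N]eq_card0 ?addn0.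
    by apply: eq_card => x; rewrite !inE ltnS [RHS]leq_eqVlt orbC.
  by move=> x; rewrite !inE; apply/negP => /andP[lt_i /eqP E]; rewrite E ltnn in lt_i.
have nthE i : nth 0 (val la) i = nth 0 (val la') i.
  have [ni|ni] := ltnP i n.
    apply/eqP; have := rowE _ T' (Ordinal ni).
    by rewrite /= -!ltE -(rowE _ T (Ordinal ni)) => /addnI/esym/eqP.
  by rewrite !nth_default // (leq_trans (intpart_size _)).
have size_le (l l' : intpart n) : nth 0 (val l) =1 nth 0 (val l') ->
    (size (val l) <= size (val l'))%N.
  move=> E; rewrite leqNgt; apply/negP => lt_s.
  have /and3P[_ /(all_nthP 0)/(_ _ lt_s) + _] := valP l.
  by rewrite E nth_default.
apply: val_inj; apply: (@eq_from_nth _ 0%N) => [|i _]; last exact: nthE.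
by apply/eqP; rewrite eqn_leq !size_le // => i; rewrite nthE.
Qed.

(** If no two numbers shared a column of [T] and a row of the translate of [T'], [card_row_lt] would
    bound the first [k] rows of [T'] by those of [T]. So a transposition kills every term. *)
Lemma col_sym_shape la la' (T : numbering la) (T' : numbering la') k p :
    (#|[set x | (rowf T x < k)%N]| < #|[set x | (rowf T' x < k)%N]|)%N ->
  sym true (colf T) (sym true (colf T') (sym false (rowf T') p)) = 0.
Proof.
move=> ltk; rewrite {2}/sym (linear_sum (sym true (colf T))) big1 // => s _; rewrite linearZ /=.
have [/existsP[x /existsP[y /and3P[xy /eqP cc /eqP rr]]]|no] := boolP
  [exists x, exists y, [&& x != y, colf T x == colf T y &
     rowf T' (s^-1%g x) == rowf T' (s^-1%g y)]].
  rewrite (sym_eq0 (stab_tperm cc)) ?scaler0 //.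
  rewrite -msymMm chi_tperm // expr1 opprK scale1r.
  have -> : (s * tperm x y = tperm (s^-1 x) (s^-1 y) * s)%g.
    by rewrite -tpermJ conjgE invgK mulgA mulgKV.
  by rewrite msymMm sym_stabl ?stab_tperm // chi_false scale1r.
have inj x y : colf T x = colf T y -> rowf T' (s^-1%g x) = rowf T' (s^-1%g y) -> x = y.
  move=> cc rr; apply/eqP; apply: contraNT no => xy.
  by apply/existsP; exists x; apply/existsP; exists y; rewrite xy cc rr !eqxx.
have := card_row_lt inj k; rewrite leqNgt => /negP[]; apply: leq_trans ltk _.
rewrite -(card_preimset _ (@perm_inj _ s^-1%g)).
by apply/eq_leq/eq_card => x; rewrite !inE.
Qed.

Lemma specht_orthogonal la la' (M : ssyt la) (M' : ssyt la') k u v :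
  la != la' -> specht_space M u -> specht_space M' v -> ip k u v = 0.
Proof.
move=> ne_la Mu; move: v; apply: lspan_ind => [|v w vE wE|a v vE|_ [T' ->]].
- exact: linear0.
- by rewrite linearD /= vE wE addr0.
- by rewrite linearZ /= vE mulr0.
move: u Mu; apply: lspan_ind => [|v w vE wE|a v vE|_ [T ->]]; rewrite ipC.
- exact: linear0.
- by rewrite linearD /= ipC vE ipC wE addr0.
- by rewrite linearZ /= ipC vE mulr0.
rewrite !specht_polyE linearZ /= ipC linearZ /=.
suff -> : ip k (sym true (colf T) (sym false (rowf T) 'X_[ssyt_mnm T M]))
   (sym true (colf T') (sym false (rowf T') 'X_[ssyt_mnm T' M'])) = 0.
  by rewrite !mulr0.
have [le1|/not_all_ex_not[j /negP]] := classic (forall k,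
  (#|[set x | (rowf T' x < k)%N]| <= #|[set x | (rowf T x < k)%N]|)%N); last first.
  by rewrite -ltnNge => /col_sym_shape z0; rewrite ip_sym z0 linear0.
have [le2|/not_all_ex_not[j /negP]] := classic (forall k,
  (#|[set x | (rowf T x < k)%N]| <= #|[set x | (rowf T' x < k)%N]|)%N); last first.
  by rewrite -ltnNge => /col_sym_shape z0; rewrite -ip_sym z0 ipC linear0.
by case/eqP: ne_la; exact: shape_eq le1 le2.
Qed.

Lemma specht_direct : subspace_direct predT
  (fun x : ssyt_index n => specht_space (tagged x) : {mpoly rat[n]} -> Prop).
Proof.
move=> s w us _ sw sum0 [la M] xs.
(* The part of shape [la] is minus the sum of the other parts, which are orthogonal to it. *)
have sumla : \sum_(x <- s | tag x == la) w x = 0.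
  pose k := msize (\sum_(x <- s | tag x == la) w x).
  apply: (@ip_eq0 _ k) => //; move: sum0.
  rewrite (bigID (fun x => tag x == la)) /= => /eqP; rewrite addr_eq0 => /eqP sumE.
  rewrite [X in ip k _ X]sumE linearN /= (linear_sum (ip k _)) big_seq_cond.
  rewrite big1 ?oppr0 // => y /andP[ys yla].
  transitivity (ip k (w y) (\sum_(x <- s | tag x == la) w x)); first exact: ipC.
  rewrite (linear_sum (ip k _)) big_seq_cond big1 // => x /andP[xs' /eqP xla].
  by apply: (specht_orthogonal _ _ (sw y ys) (sw x xs')); rewrite xla.
pose inc (M : ssyt la) : ssyt_index n := existT _ la M.
have [l lE] : exists l, [seq x <- s | tag x == la] = map inc l.
  elim: s {us sw sum0 xs sumla} => [|[la' M'] s [l lE]]; first by exists [::].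
  rewrite /=; case: eqP => [E|_]; last by exists l.
  by move: E => /= E; subst la'; exists (M' :: l); rewrite lE.
have inc_inj : injective inc.
  by move=> M1 M2 /eqP; rewrite -tag_eqE /tag_eq eqxx /= tagged_asE => /eqP.
have memE M' : (M' \in l) = (inc M' \in s).
  by rewrite -(mem_map inc_inj) -lE mem_filter eqxx.
apply: (direct_same_shape (l := l) (w := fun M => w (inc M))); last by rewrite memE.
- by rewrite -(map_inj_uniq inc_inj) -lE filter_uniq.
- by move=> M' M'l; apply: (sw (inc M')); rewrite -memE.
by rewrite -(big_map inc predT w) -lE big_filter.
Qed.

End Shapes.

(** * Grading *)

Section Grading.
Variables (n : nat) (K : eqType) (cls : 'X_{1..n} -> K) (ssyt_cls : ssyt_index n -> K).
Implicit Types (p : {mpoly rat[n]}) (k : K).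
Hypothesis cls_perm : forall (m : 'X_{1..n}) (s : 'S_n),
  cls [multinom m (s i) | i < n] = cls m.
Hypothesis cls_ssyt : forall x (T : numbering (tag x)),
  cls (ssyt_mnm T (tagged x)) = ssyt_cls x.

(** The span of the monomials of class [k], expressed by coefficients; the class is the degree in
    one application and the multiset of exponents in the other. *)
Definition pure k p := forall m, p@_m != 0 -> cls m = k.

Lemma pure0 k : pure k 0.
Proof. by move=> m; rewrite mcoeff0 eqxx. Qed.

Lemma pureD k p q : pure k p -> pure k q -> pure k (p + q).
Proof.
move=> pk qk m; rewrite mcoeffD; have [p0|/pk //] := eqVneq p@_m 0.
by rewrite p0 add0r => /qk.
Qed.

Lemma pureZ k a p : pure k p -> pure k (a *: p).
Proof. by move=> pk m; rewrite mcoeffZ mulf_eq0 negb_or => /andP[_ /pk]. Qed.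

Lemma pure_sum k (I : eqType) (s : seq I) (F : I -> {mpoly rat[n]}) :
  (forall i, i \in s -> pure k (F i)) -> pure k (\sum_(i <- s) F i).
Proof.
move=> sF; rewrite big_seq; apply: (big_ind (pure k)) => //; first exact: pure0.
by move=> p q; exact: pureD.
Qed.

Lemma pure_sym k e c p : pure k p -> pure k (sym e c p).
Proof.
move=> pk; rewrite /sym; apply: (big_ind (pure k)).
- exact: pure0.
- by move=> u v; exact: pureD.
by move=> s _; apply: pureZ => m; rewrite mcoeff_sym => /pk; rewrite cls_perm.
Qed.

Lemma pure_specht (x : ssyt_index n) p :
  specht_space (tagged x) p -> pure (ssyt_cls x) p.
Proof.
move: p; apply: lspan_ind => [|u v|a v|_ [T ->]].
- exact: pure0.
- exact: pureD.
- exact: pureZ.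
rewrite specht_polyE; apply/pureZ/pure_sym/pure_sym => m.
rewrite mcoeffX; case: (eqVneq _ m) => [<- _|_]; last by rewrite eqxx.
exact: cls_ssyt.
Qed.

(** A full decomposition is restricted to the indices of class [k]. Summands being pure, the
    discarded ones have no monomial of class [k], and at other monomials both sides are 0. *)
Lemma graded_direct_sum k (U : {mpoly rat[n]} -> Prop) :
    (forall p, U p <-> pure k p) ->
  is_direct_sum (fun x => ssyt_cls x == k) (fun x => specht_space (tagged x)) U.
Proof.
move=> UE; split; last first.
  by move=> s w us _; apply: specht_direct; rewrite ?all_predT.
move=> p; rewrite UE; split=> [pk|[s [w [us /allP sk sw ->]]]]; last first.
  by apply: pure_sum => x xs; rewrite -(eqP (sk x xs)); exact/pure_specht/sw.
have [s [w [us _ sw pE]]] := lspan_subspace_sum (specht_poly_span p).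
exists [seq x <- s | ssyt_cls x == k], w; split.
- exact: filter_uniq.
- exact: filter_all.
- by move=> x; rewrite mem_filter => /andP[_ /sw].
apply/mpolyP => m; have [mk|mk] := eqVneq (cls m) k.
  rewrite {1}pE !(linear_sum (mcoeff m)) big_filter [RHS]big_mkcond.
  rewrite [LHS]big_seq [RHS]big_seq; apply: eq_bigr => x xs /=.
  case: eqP => // xk; apply/eqP; apply: contraT => /(pure_specht (sw x xs)).
  by rewrite mk => /esym.
have -> : p@_m = 0 by apply/eqP; apply: contraNT mk => /pk ->.
rewrite (linear_sum (mcoeff m)) big_seq big1 // => x; rewrite mem_filter.
move=> /andP[/eqP xk xs]; apply/eqP; apply: contraNT mk => /(pure_specht (sw x xs)) ->.
by rewrite xk.
Qed.

End Grading.

Theorem theorem2p34 (n d : nat) (n_gt0 : (0 < n)%N) :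
  is_direct_sum (fun x : ssyt_index n => ssyt_sum (tagged x) == d)
    (fun x => specht_space (tagged x))
    (fun p : {mpoly rat[n]} => p \is d.-homog)
  /\
  (forall mu : {mset nat}%mset,
     size mu = n -> (\sum_(a <- mu) a)%N = d ->
     is_direct_sum (fun x : ssyt_index n => ssyt_content (tagged x) == mu)
       (fun x => specht_space (tagged x))
       (content_space (n := n) mu)).
Proof.
split=> [|mu _ _].
  apply: (graded_direct_sum (cls := mdeg)) => [m s|[la M] T|p].
  - exact: mdeg_mperm.
  - rewrite mdegE /ssyt_sum /= (reindex (box_of T)) /=.
      by apply: eq_bigr => i _; rewrite mnmE.
    by exists (val T) => b _; [exact: box_ofK | exact: numberingK].
  split=> [/dhomogP ph m|pd]; first by rewrite -mcoeff_msupp => /ph.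
  by apply/dhomogP => m; rewrite mcoeff_msupp => /pd.
apply: (graded_direct_sum (cls := fun m : 'X_{1..n} => seq_mset [seq m i | i : 'I_n])).
- move=> m s; apply/eq_seq_msetP.
  have -> : [seq [multinom m (s i) | i < n] i | i : 'I_n] = map m (map s (enum 'I_n)).
    by rewrite -map_comp; apply: eq_map => i; rewrite mnmE.
  apply: perm_map; apply: uniq_perm; [|exact: enum_uniq|move=> i].
    by rewrite map_inj_uniq ?enum_uniq //; exact: perm_inj.
  rewrite mem_enum; apply/mapP; exists (s^-1%g i); rewrite ?mem_enum //.
  by rewrite permKV.
- move=> [la M] T; apply/eq_seq_msetP => /=.
  have -> : [seq ssyt_mnm T M i | i : 'I_n] = map (val M) (map (box_of T) (enum 'I_n)).
    by rewrite -map_comp; apply: eq_map => i; rewrite mnmE.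
  apply: perm_map; apply: uniq_perm; [|exact: enum_uniq|move=> b].
    by rewrite map_inj_uniq ?enum_uniq //; exact: can_inj (box_ofK T).
  rewrite mem_enum; apply/mapP; exists (val T b); rewrite ?mem_enum //.
  by rewrite numberingK.
move=> p; split=> [|pm].
  apply: lspan_ind => [|u v|a v|_ [m <- ->]].
  - exact: pure0.
  - exact: pureD.
  - exact: pureZ.
  by move=> m'; rewrite mcoeffX; case: (eqVneq m m') => [->|]; rewrite ?eqxx.
rewrite [p]mpolyE; apply: lspan_sum => m mp.
apply/lspanZ/lspan_gen; exists m => //; apply: pm.
by rewrite -mcoeff_msupp.
Qed.
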